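(* The action of $G$ on $\mathcal{M}^*$ by reparametrization is proper in the following sense: given any two maps $f_1, f_2 \in \mathcal{M}^*$, there exist small neighbourhoods $U_{\epsilon_1}(f_1)$ of $f_1$ and $U_{\epsilon_2}(f_2)$ of $f_2$ in $\mathcal{M}^*$ and two compact sets $K_{f_1}, K_{f_2} \subset G$ such that (a) for any $h \in U_{\epsilon_1}(f_1)$ and any $g \in G \setminus K_{f_1}$, the map $h\circ g$ is not in $U_{\epsilon_2}(f_2)$; and (b) for any $h \in U_{\epsilon_2}(f_2)$ and any $g \in G\setminus K_{f_2}$, the map $h \circ g$ is not in $U_{\epsilon_1}(f_1)$.
   Context: $M$ is a compact $C^\infty$-manifold with a Riemannian metric. $\Sigma \simeq S^2 \simeq \mathbf{CP}^1$ with its standard complex structure and round metric. $G_0 \simeq PSL(2,\mathbf{C})$ acts on $\Sigma$ as the group of reparametrizations (Möbius transformations); $G_1$ (resp. $G_2$) is the subgroup of $G_0$ fixing one marked point $x_1$ (resp. each of two distinct marked points $x_1, x_2$) of $\Sigma$. $G$ denotes any one of the three groups $G_0, G_1, G_2$, with its Lie group topology. The Sobolev order $k$ and exponent $p$ are fixed with $k - \frac{2}{p} > 1$. $\mathcal{M} = \mathcal{M}_{k,p}(\Sigma, M)$ is the space of maps $\Sigma \to M$ of Sobolev class $L_k^p$ ($k$ derivatives in $L^p$), with its $L_k^p$-topology, and $\mathcal{M}^* \subset \mathcal{M}$ is the subspace of non-constant maps. $G$ acts on $\mathcal{M}$ by $(g,f) \mapsto f \circ g$. $U_\epsilon(f)$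 denotes the open $\epsilon$-neighbourhood of $f$ in the $L_k^p$-norm (measured in exponential coordinates at $f$, or equivalently via an embedding of $M$ into some $\mathbf{R}^m$). *)

(* Defs.v *)
From HB Require Import structures.
From mathcomp Require Import all_boot all_order all_algebra.
From mathcomp Require Import all_classical all_reals all_analysis.
From mathcomp Require Import complex generic_quotient.

Set Implicit Arguments.
Unset Strict Implicit.
Unset Printing Implicit Defensive.

Import Order.TTheory GRing.Theory Num.Theory numFieldNormedType.Exports.
Local Open Scope classical_set_scope.
Local Open Scope ring_scope.
Local Open Scope quotient_scope.

(* For open [U] this is C^oo: every iterated directional derivative is
   differentiable, hence continuous, on [U]. *)
Definition smooth_on (R : realType) (V W : normedModType R) (U : set V)
    (f : V -> W) : Prop :=
  forall (s : seq V) (x : V), U x ->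
    differentiable (foldr (fun v g => 'D_v g) f s : V -> W) x.

Record chart (R : realType) (n : nat) (M : topologicalType) := Chart {
  chart_dom : set M;
  chart_fun :> M -> 'rV[R]_n;
  chart_inv : 'rV[R]_n -> M }.

Section Manifold.
Context {R : realType} {n : nat} {M : topologicalType}.
Implicit Types (c d : chart R n M) (A : set (chart R n M)).

Definition chart_img c : set 'rV[R]_n := c @` chart_dom c.

Definition is_chart c : Prop :=
  [/\ open (chart_dom c),
      open (chart_img c),
      forall x, chart_dom c x -> chart_inv c (c x) = x,
      {within chart_dom c, continuous c} &
      {within chart_img c, continuous (chart_inv c)}].

Definition transition c d : 'rV[R]_n -> 'rV[R]_n := d \o chart_inv c.

Definition transition_dom c d : set 'rV[R]_n :=
  c @` (chart_dom c `&` chart_dom d).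

Definition smooth_atlas A : Prop :=
  [/\ forall c, A c -> is_chart c,
      forall x : M, exists2 c, A c & chart_dom c x &
      forall c d, A c -> A d -> smooth_on (transition_dom c d) (transition c d)].

(* Second countability is not listed: it follows from compactness. *)
Definition compact_manifold A : Prop :=
  [/\ hausdorff_space M, compact [set: M] & smooth_atlas A].

(* [rho c] is the Gram matrix of the metric in the chart [c]; since
   ['d t x u = u *m jacobian t x], the last clause is the tensoriality rule. *)
Definition riemannian_metric A (rho : chart R n M -> 'rV[R]_n -> 'M[R]_n) :
    Prop :=
  [/\ forall c, A c -> smooth_on (chart_img c) (rho c),
      forall c x, A c -> chart_img c x -> (rho c x)^T = rho c x,
      forall c x (v : 'rV[R]_n), A c -> chart_img c x -> v != 0 ->
        0 < (v *m rho c x *m v^T) 0 0 &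
      forall c d x, A c -> A d -> transition_dom c d x ->
        let J := jacobian (transition c d) x in
        rho c x = J *m rho d (transition c d x) *m J^T].

Definition smooth_embedding (m : nat) A (iota : M -> 'rV[R]_m) : Prop :=
  [/\ forall c, A c -> smooth_on (chart_img c) (iota \o chart_inv c),
      forall c x, A c -> chart_img c x ->
        injective ('d (iota \o chart_inv c) x : 'rV[R]_n -> 'rV[R]_m),
      injective iota &
      forall U : set M, open U ->
        exists2 V : set 'rV[R]_m, open V & iota @` U = V `&` range iota].

End Manifold.

Section Sobolev.
Context {R : realType}.
Implicit Types (Omega : set (R * R)) (u v phi : R * R -> R).

Definition lebesgue2 := (@lebesgue_measure R \x @lebesgue_measure R)%E.

Definition partial (a b : nat) phi : R * R -> R :=
  iter a (fun g : R * R -> R => 'D_((1, 0) : R * R) g)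
    (iter b (fun g : R * R -> R => 'D_((0, 1) : R * R) g) phi).

Definition test_function Omega phi : Prop :=
  smooth_on [set: R * R] (phi : R * R -> R^o) /\
  exists K : set (R * R), [/\ compact K, K `<=` Omega &
    forall z, ~ K z -> phi z = 0].

Definition loc_integrable Omega u : Prop :=
  forall K : set (R * R), compact K -> K `<=` Omega ->
    lebesgue2.-integrable K (EFin \o u).

Definition is_weak_derivative Omega (a b : nat) u v : Prop :=
  [/\ loc_integrable Omega u,
      loc_integrable Omega v &
      forall phi, test_function Omega phi ->
        \int[lebesgue2]_(z in Omega) (u z * partial a b phi z) =
        (-1) ^+ (a + b) * \int[lebesgue2]_(z in Omega) (v z * phi z)].

Definition sobolev (k : nat) (p : R) Omega u : Prop :=
  forall a b : nat, (a + b <= k)%N ->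
    exists2 v, is_weak_derivative Omega a b u v &
      v \_ Omega \in Lfun lebesgue2 p%:E.

(* Unique up to equality almost everywhere when it exists. *)
Definition weak_derivative Omega (a b : nat) u : R * R -> R :=
  xget (fun=> 0) [set v | is_weak_derivative Omega a b u v].

Definition sobolev_norm (k : nat) (p : R) Omega u : \bar R :=
  (\sum_(ab : 'I_k.+1 * 'I_k.+1 | (ab.1 + ab.2 <= k)%N)
    'N[lebesgue2]_(p%:E)
      [EFin \o (weak_derivative Omega ab.1 ab.2 u \_ Omega)])%E.

End Sobolev.

(* The canonical topology of [R[i]] is found through [numFieldType]. *)
Definition Cplx (R : realType) : numFieldType := R[i].

(* CP^1, with [Some z = [z : 1]] and [None = [1 : 0]]. *)
Definition sphere (R : realType) : Type := option (Cplx R).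

Section Moebius.
Context {R : realType}.

Definition moebius_mx (A : 'M[Cplx R]_2) (x : sphere R) : sphere R :=
  let: (u, v) := if x is Some z then (z, 1) else (1, 0) in
  let s := A 0 0 * u + A 0 1 * v in
  let t := A 1 0 * u + A 1 1 * v in
  if t == 0 then None else Some (s / t).

Definition SL2 : set 'M[Cplx R]_2 := [set A | \det A = 1].

Definition SL2_opp (A B : SL2) : bool :=
  (val A == val B) || (val A == - val B).

Lemma SL2_opp_refl : reflexive SL2_opp.
Proof. by move=> A; rewrite /SL2_opp eqxx. Qed.

Lemma SL2_opp_sym : symmetric SL2_opp.
Proof. by move=> A B; rewrite /SL2_opp eq_sym -eqr_oppLR (eq_sym (- _)). Qed.

Lemma SL2_opp_trans : transitive SL2_opp.
Proof.
move=> B A C; rewrite /SL2_opp => /orP[] /eqP -> /orP[] /eqP ->;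
  by rewrite ?opprK eqxx ?orbT.
Qed.

Definition SL2_equiv := EquivRel SL2_opp SL2_opp_refl SL2_opp_sym SL2_opp_trans.

Definition PSL2 := quotient_topology {eq_quot SL2_equiv}.

Definition moebius (g : PSL2) : sphere R -> sphere R :=
  moebius_mx (val (repr g)).

Lemma moebius_mxN (A : 'M[Cplx R]_2) : moebius_mx (- A) =1 moebius_mx A.
Proof.
move=> x; rewrite /moebius_mx; case: (if x is Some z then _ else _) => u v /=.
rewrite !mxE !mulNr -!opprD oppr_eq0.
by case: ifP => // _; rewrite invrN mulrNN.
Qed.

Lemma moebius_pi (A : SL2) : moebius (\pi_PSL2 A) =1 moebius_mx (val A).
Proof.
move=> x; rewrite /moebius.
have /eqmodP : repr (\pi_PSL2 A) = A %[mod PSL2] by rewrite reprK.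
by move=> /orP[] /eqP ->; rewrite ?moebius_mxN.
Qed.

Definition G0 : set PSL2 := [set: PSL2].
Definition G1 (x1 : sphere R) : set PSL2 := [set g | moebius g x1 = x1].
Definition G2 (x1 x2 : sphere R) : set PSL2 :=
  [set g | moebius g x1 = x1 /\ moebius g x2 = x2].

End Moebius.
Arguments PSL2 : clear implicits.
Arguments G0 : clear implicits.

Section SobolevMaps.
Context {R : realType}.

Definition toC (z : R * R) : Cplx R := (z.1 +i* z.2)%C.

(* The two holomorphic charts z |-> [z : 1] and z |-> [1 : z] of CP^1. *)
Definition sphere_chart (b : bool) (z : R * R) : sphere R :=
  if b then Some (toC z)
  else if toC z == 0 then None else Some (toC z)^-1.

(* The images of this disc under the two charts form an open cover of CP^1. *)
Definition disc : set (R * R) := [set z | z.1 ^+ 2 + z.2 ^+ 2 < 4].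

Definition ae_sphere (P : sphere R -> Prop) : Prop :=
  forall b, {ae (@lebesgue2 R), forall z, P (sphere_chart b z)}.

Section Target.
Context {M : topologicalType} {m : nat}.
Variables (iota : M -> 'rV[R]_m) (k : nat) (p : R).

Definition sphere_sobolev (F : sphere R -> 'rV[R]_m) : Prop :=
  forall (b : bool) (i : 'I_m),
    sobolev k p disc (fun z => F (sphere_chart b z) 0 i).

(* On the compact surface CP^1 this defines the L_k^p-norm up to equivalence:
   the round metric is comparable with the flat metric of the charts on [disc],
   with bounded derivatives of all orders. *)
Definition sphere_sobolev_norm (F : sphere R -> 'rV[R]_m) : \bar R :=
  (\sum_(b : bool) \sum_(i < m)
    sobolev_norm k p disc (fun z => F (sphere_chart b z) 0%R i))%E.

(* Elements of L_k^p are classes of maps up to equality almost everywhere; here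
   they are given by arbitrary Borel representatives, and the notions below do
   not depend on the choice of the representative. *)
Definition is_map (f : sphere R -> M) : Prop := sphere_sobolev (iota \o f).

Definition nonconstant_map (f : sphere R -> M) : Prop :=
  is_map f /\ ~ exists q : M, ae_sphere (fun x => f x = q).

Definition U_ (eps : R) (f h : sphere R -> M) : Prop :=
  nonconstant_map h /\
  (sphere_sobolev_norm (fun x => (iota (h x) - iota (f x))%R) < eps%:E)%E.

End Target.
End SobolevMaps.

(* Main.v *)
Require Import Defs.
From HB Require Import structures.
From mathcomp Require Import all_boot all_order all_algebra.
From mathcomp Require Import all_classical all_reals all_analysis.
From mathcomp Require Import measurable_realfun complex generic_quotient.
From mathcomp Require Import ring lra.
Import Order.TTheory GRing.Theory Num.Theory numFieldNormedType.Exports.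
Local Open Scope classical_set_scope.
Local Open Scope ring_scope.

(** Since [k >= 2], for an [L_k^p] function [u] on the disc and a cut-off
    function [chi] bounded below on a smaller square, [chi u] agrees almost
    everywhere with the iterated primitive of its mixed weak derivative.  Hence
    a small [L_k^p]-norm bounds [u] almost everywhere, and [u] is uniformly continuous
    off a null set.  A matrix of SL2 with a large entry maps the complement of
    a set [E] of small diameter to a set of small diameter.  So when [g] leaves
    a large compact set, [f1 \o g], and with it [h \o g] for [h] close to [f1],
    oscillates little off such an [E]; if [h \o g] were close to [f2], then so
    would [f2].  A map with this property at all scales is constant almost
    everywhere.  The compact sets are the images in PSL2 of the matrices with
    bounded entries that fix the marked points. *)

Set Implicit Arguments.
Unset Strict Implicit.
Unset Printing Implicit Defensive.

(** The obstacle is that the L_k^p-norm of [h \o g] is not controlled by that of [h] while [g] runs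
    through a noncompact group. Sup bounds outside null sets do survive composition with [g],
    because Moebius maps preserve null sets; so closeness in [U_] is used only through the sup bound
    that it implies, and [f1] only through its uniform continuity. Maps are arbitrary
    representatives, hence every pointwise statement is restricted to a set of full measure. The
    mixed derivative of order (1, 1) is the right one because integrating it over lower-left
    quadrants returns the function, so that L^1 bounds on derivatives up to order 2 already give sup
    bounds and continuity, whatever [p >= 1] is. The radii are nested: charts live on the disc of
    radius 2, the cut-off on the square of half-side 7/5 inside it, estimates hold on half-side 5/4,
    and the closed unit discs of the two charts already cover the sphere. The gap between 1 and 5/4
    lets two close points of the sphere be seen in one chart. *)

(** * Smooth functions of one variable and their tensor products *)

Section SmoothFunctions.
Context {R : realType}.
Implicit Types (f g : R -> R) (x y c : R).

(** The classical flat function exp(-1/x) divided by x^k: the derivative of a member of this family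
    is a linear combination of members with larger [k]. *)
Definition flat k x : R := if 0 < x then x ^- k * expR (- x^-1) else 0.

(* Any class of functions that contains what is needed and is closed under
   derivation would do; it serves to produce all derivatives at once. *)
Inductive smooth1 : (R -> R) -> Prop :=
| smooth1_cst c : smooth1 (fun=> c)
| smooth1_id : smooth1 id
| smooth1_flat k : smooth1 (flat k)
| smooth1D f g : smooth1 f -> smooth1 g -> smooth1 (fun x => f x + g x)
| smooth1M f g : smooth1 f -> smooth1 g -> smooth1 (fun x => f x * g x)
| smooth1_affine f a b : smooth1 f -> smooth1 (fun x => f (a * x + b)).

Lemma flat_ge0 k x : 0 <= flat k x.
Proof.
rewrite /flat; case: ifP => // x0.
by rewrite mulr_ge0 ?expR_ge0// invr_ge0 exprn_ge0// ltW.
Qed.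

Lemma flat_gt0 k x : 0 < x -> 0 < flat k x.
Proof.
by move=> x0; rewrite /flat x0 mulr_gt0 ?expR_gt0// invr_gt0 exprn_gt0.
Qed.

Lemma flat_le0 k x : x <= 0 -> flat k x = 0.
Proof. by rewrite /flat ltNge => ->. Qed.

(** The term of order [k.+2] in the series of exp(1/x) absorbs the pole x^-k and leaves two powers
    of x, which makes the derivative at 0 exist and vanish. *)
Lemma flat_le_sqr k x : flat k x <= (k.+2)`!%:R * x ^+ 2.
Proof.
rewrite /flat; case: ifP => [x0|_]; last by rewrite mulr_ge0// sqr_ge0.
have xi0 : 0 < x^-1 by rewrite invr_gt0.
have h := @expR_ge1Dxn R x^-1 k.+1 (ltW xi0).
have h1 : x ^- k.+2 / (k.+2)`!%:R <= expR x^-1.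
  by apply: le_trans h; rewrite -exprVn lerDr.
have f0 : (0 : R) < (k.+2)`!%:R by rewrite ltr0n fact_gt0.
rewrite expRN.
have h2 : (expR x^-1)^-1 <= (k.+2)`!%:R * x ^+ k.+2.
  rewrite -[leRHS]invrK lef_pV2 ?posrE ?expR_gt0//; last first.
    by rewrite invr_gt0 mulr_gt0// exprn_gt0.
  by rewrite invfM mulrC.
apply: le_trans (_ : x ^- k * ((k.+2)`!%:R * x ^+ k.+2) <= _).
  by rewrite ler_pM2l// invr_gt0 exprn_gt0.
rewrite mulrCA -addn2 exprD mulKf// expf_neq0//.
by rewrite gt_eqF.
Qed.

Lemma is_derive_sqr_bound f x C :
  (forall h, `|f (h + x) - f x| <= C * h ^+ 2) -> is_derive x 1 f 0.
Proof.
move=> fC.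
have cv : h^-1 *: (f (h *: 1 + x) - f x) @[h --> 0^'] --> (0 : R).
  apply/cvgrPdist_le => e e0.
  have C0 : 0 <= C by have := fC 1; rewrite expr1n mulr1; apply: le_trans.
  have C1 : 0 < C + 1 by rewrite ltr_wpDl.
  near=> h.
  have h0 : h != 0 by near: h; exact: nbhs_dnbhs_neq.
  rewrite sub0r normrN normrZ normrV ?unitfE//.
  rewrite ler_pdivrMl ?normr_gt0//.
  rewrite [h *: 1]mulr1 (le_trans (fC h))// -real_normK ?num_real//.
  rewrite expr2 mulrCA ler_wpM2l//.
  have : `|h| <= e / (C + 1).
    near: h; apply: dnbhs0_le; rewrite divr_gt0//.
  rewrite ler_pdivlMr// => /(le_trans _); apply.
  by rewrite mulrC ler_wpM2l// lerDl.
by split; [apply/cvg_ex; exists 0|apply/cvg_lim].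
Unshelve. all: by end_near.
Qed.

Lemma is_derive_flat k x :
  is_derive x 1 (flat k) (flat k.+2 x - k%:R * flat k.+1 x).
Proof.
have [x0|x0|->] := ltgtP x 0.
- rewrite !flat_le0 ?ltW// mulr0 subr0.
  apply: (@near_eq_is_derive _ _ _ (cst 0) _ x 1 0).
  near=> y; rewrite /cst/= flat_le0// ltW//.
  near: y; exact: lt_nbhsl.
- pose g (y : R) := y ^- k * expR (- y^-1).
  apply: (@near_eq_is_derive _ _ _ g).
    near=> y; rewrite /flat/g; have -> // : 0 < y.
    near: y; exact: lt_nbhsr.
  have x0' : x != 0 by rewrite gt_eqF.
  have xk : x ^+ k != 0 by rewrite expf_neq0.
  have d0 : is_derive x 1 (fun y : R => - y^-1) (x ^- 2).
    apply: is_derive_eq (is_deriveN (is_deriveV (f := id) x0' _)) _.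
    by rewrite [_ *: _]mulr1 opprK.
  have d1 : is_derive x 1 (fun y => expR (- y^-1)) (expR (- x^-1) * x ^- 2).
    exact: (@is_derive1_comp _ expR (fun y => - y^-1)).
  have d2 : is_derive x 1 (fun y : R => y ^- k) (- k%:R * x ^- k.+1).
    have h := is_deriveX k (is_derive_id x (1 : R)).
    rewrite exprfctE in h.
    apply: is_derive_eq (is_deriveV (f := fun y : R => y ^+ k) xk h) _.
    rewrite [_%:A]mulr1 [_ *: _]mulrC mulrN mulNr; congr (- _).
    case: (k) xk => [|k'] xk /=; first by rewrite !mul0r.
    rewrite !exprS; rewrite exprS mulf_eq0 negb_or x0' /= in xk.
    by field; rewrite x0' xk.
  apply: is_derive_eq (is_deriveM d2 d1) _.
  rewrite /flat x0 -[_ *: _]/(_ * _) -[X in _ + X]/(_ * _).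
  rewrite !exprS.
  by field; rewrite x0' xk.
- rewrite !flat_le0 // mulr0 subr0.
  apply: (@is_derive_sqr_bound _ _ (k.+2)`!%:R) => h.
  by rewrite addr0 (flat_le0 k (lexx 0)) subr0 ger0_norm ?flat_ge0 ?flat_le_sqr.
Unshelve. all: by end_near.
Qed.

Lemma smooth1_derive f : smooth1 f ->
  exists2 f', smooth1 f' & forall x, is_derive x 1 f (f' x).
Proof.
elim=> {f} [c||k|f g Sf [f' Sf' df] Sg [g' Sg' dg]|
    f g Sf [f' Sf' df] Sg [g' Sg' dg]|f a b Sf [f' Sf' df]].
- by exists (fun=> 0) => [|x]; [exact: smooth1_cst|exact: is_derive_cst].
- by exists (fun=> 1) => [|x]; [exact: smooth1_cst|exact: is_derive_id].
- exists (fun x => flat k.+2 x + (- k%:R) * flat k.+1 x) => [|x].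
    apply: smooth1D; first exact: smooth1_flat.
    by apply: smooth1M; [exact: smooth1_cst|exact: smooth1_flat].
  by rewrite mulNr; exact: is_derive_flat.
- exists (fun x => f' x + g' x) => [|x]; first exact: smooth1D.
  exact: is_deriveD.
- exists (fun x => f x * g' x + g x * f' x) => [|x].
    by apply: smooth1D; exact: smooth1M.
  exact: is_deriveM.
- exists (fun x => f' (a * x + b) * a) => [|x].
    by apply: smooth1M; [exact: smooth1_affine|exact: smooth1_cst].
  apply: (@is_derive1_comp _ f (fun x => a * x + b)).
  have h := is_deriveD (is_deriveZ a (is_derive_id x (1 : R)))
    (is_derive_cst b x (1 : R)).
  by apply: is_derive_eq h _; rewrite addr0 [_ *: _]mulr1.
Qed.

Definition tensor f g (z : R * R) : R := f z.1 * g z.2.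

Lemma is_diff_tensor f g (z : R * R) (f' g' : R) :
    is_derive z.1 (1 : R) f f' -> is_derive z.2 (1 : R) g g' ->
  is_diff z (tensor f g : R * R -> R^o)
    (fun v => f' * g z.2 * v.1 + f z.1 * g' * v.2).
Proof.
move=> df dg.
have Df : is_diff (z.1) (f : R -> R^o) (fun h => h * f').
  have /derivable1_diffP dif : derivable f z.1 1 by exact: ex_derive.
  apply: DiffDef => //; apply/funext => h /=.
  by rewrite -[h in LHS]mulr1 -[_ * 1]/(h *: (1 : R)) linearZ/= -deriveE// derive_val.
have Dg : is_diff (z.2) (g : R -> R^o) (fun h => h * g').
  have /derivable1_diffP dif : derivable g z.2 1 by exact: ex_derive.
  apply: DiffDef => //; apply/funext => h /=.
  by rewrite -[h in LHS]mulr1 -[_ * 1]/(h *: (1 : R)) linearZ/= -deriveE// derive_val.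
have D1 : is_diff z (fst : R * R -> R^o) fst.
  have c : continuous (fst : R * R -> R^o) by move=> ?; exact: cvg_fst.
  apply: DiffDef; first exact: linear_differentiable.
  exact: (diff_lin z c).
have D2 : is_diff z (snd : R * R -> R^o) snd.
  have c : continuous (snd : R * R -> R^o) by move=> ?; exact: cvg_snd.
  apply: DiffDef; first exact: linear_differentiable.
  exact: (diff_lin z c).
apply: is_diff_eq (is_diffM (is_diff_comp D1 Df) (is_diff_comp D2 Dg)) _.
apply/funext => v /=.
rewrite -[LHS]/(f z.1 * (v.2 * g') + g z.2 * (v.1 * f')).
by ring.
Qed.

(** A directional derivative of a tensor product is a sum of two tensor products; including sums
    makes the class stable under the iterated derivatives of [smooth_on]. *)
Inductive sepfun : (R * R -> R) -> Prop :=
| sepfun_tensor f g : smooth1 f -> smooth1 g -> sepfun (tensor f g)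
| sepfunD phi psi : sepfun phi -> sepfun psi -> sepfun (fun z => phi z + psi z).

Lemma derive_tensor f g f' g' v :
    (forall x, is_derive x (1 : R) f (f' x)) ->
    (forall x, is_derive x (1 : R) g (g' x)) ->
  'D_v (tensor f g : R * R -> R^o) =
  fun z => tensor (fun x => v.1 * f' x) g z + tensor f (fun x => v.2 * g' x) z.
Proof.
move=> df dg; apply/funext => z.
have h := is_diff_tensor (df z.1) (dg z.2).
rewrite deriveE; last exact: ex_diff.
by rewrite diff_val /tensor /=; ring.
Qed.

Lemma sepfun_derive phi v : sepfun phi ->
  (forall z, differentiable (phi : R * R -> R^o) z) /\
  sepfun ('D_v (phi : R * R -> R^o)).
Proof.
elim=> {phi} [f g Sf Sg|phi psi _ [phid Sphi] _ [psid Spsi]].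
  have [[f' Sf' df] [g' Sg' dg]] := (smooth1_derive Sf, smooth1_derive Sg).
  split=> [z|].
    have h := is_diff_tensor (df z.1) (dg z.2); exact: ex_diff.
  rewrite (derive_tensor v df dg).
  apply: sepfunD; apply: sepfun_tensor => //;
    apply: smooth1M => //; exact: smooth1_cst.
split=> [z|]; first exact: differentiableD.
suff -> : 'D_v ((fun z => phi z + psi z) : R * R -> R^o) =
  (fun z => 'D_v (phi : R * R -> R^o) z + 'D_v (psi : R * R -> R^o) z).
  exact: sepfunD.
apply/funext => z; apply: deriveD; exact/diff_derivable.
Qed.

Lemma smooth_on_sepfun phi : sepfun phi ->
  smooth_on [set: R * R] (phi : R * R -> R^o).
Proof.
move=> Sphi s z _.
set psi := foldr _ _ _; suff : sepfun psi by move=> /(sepfun_derive 0)[].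
by rewrite {}/psi; elim: s => //= v s /(sepfun_derive v)[].
Qed.

(** The orders are booleans because the argument differentiates at most once in each variable. *)
Lemma partial_tensor (a b : bool) f g f' g' : smooth1 g' ->
    (forall x, is_derive x (1 : R) f (f' x)) ->
    (forall x, is_derive x (1 : R) g (g' x)) ->
  partial a b (tensor f g) =
  tensor (if a then f' else f) (if b then g' else g).
Proof.
move=> Sg' df dg.
have D1 g0 g0' : (forall x, is_derive x (1 : R) g0 (g0' x)) ->
  'D_((1, 0) : R * R) (tensor f g0 : R * R -> R^o) = tensor f' g0.
  move=> h.
  rewrite (derive_tensor _ df h); apply/funext => z.
  by rewrite /tensor/= mul1r mul0r mulr0 addr0.
have D2 : 'D_((0, 1) : R * R) (tensor f g : R * R -> R^o) = tensor f g'.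
  rewrite (derive_tensor _ df dg); apply/funext => z.
  by rewrite /tensor/= mul1r mul0r mul0r add0r.
rewrite /partial; case: a; case: b => //=.
- by rewrite D2; have [g'' _ dg'] := smooth1_derive Sg'; exact: (D1 _ _ dg').
- exact: (D1 _ _ dg).
Qed.

End SmoothFunctions.

(** * Integrals that vanish on a generating family of sets *)

Section ZeroIntegrals.
Local Open Scope ereal_scope.

(** The pi-lambda theorem: the sets [A] over which the integral vanishes form a Dynkin system
    containing [G]. *)
Lemma integral_preimage_eq0 d d' (S : measurableType d) (T : measurableType d')
    (R : realType) (mu : {measure set S -> \bar R}) (pi : S -> T) (B : set S)
    (f : S -> \bar R) (G : set (set T)) :
  measurable_fun setT pi -> measurable B -> mu.-integrable setT f ->
  setI_closed G -> (@measurable _ T) = <<s G >> ->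
  \int[mu]_(x in B) f x = 0 ->
  (forall A, G A -> \int[mu]_(x in pi @^-1` A `&` B) f x = 0) ->
  forall A, measurable A -> \int[mu]_(x in pi @^-1` A `&` B) f x = 0.
Proof.
move=> mpi mB fi IG mG B0 G0.
have mP A : measurable A -> measurable (pi @^-1` A `&` B).
  by move=> mA; apply: measurableI => //; rewrite -[X in measurable X]setTI; exact: mpi.
have iP A : measurable A -> mu.-integrable A f.
  by move=> mA; apply: integrableS fi.
pose H := [set A : set T | measurable A /\ \int[mu]_(x in pi @^-1` A `&` B) f x = 0].
suff GH : <<s G >> `<=` H by move=> A mA; apply: (GH A _).2; rewrite -mG.
rewrite -setI_closed_g_dynkin_g_sigma_algebra//.
apply: smallest_sub => [|A GA]; last first.
  by split; [rewrite mG; exact: sub_sigma_algebra|exact: G0].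
split.
- by split=> //; rewrite preimage_setT setTI.
- move=> A [mA A0]; split; first exact: measurableC.
  have : \int[mu]_(x in (pi @^-1` A `&` B) `|` (pi @^-1` (~` A) `&` B)) f x = 0.
    by rewrite -setIUl preimage_setC setUCr setTI.
  rewrite integral_setU ?A0 ?add0e//.
  + exact: mP.
  + by apply: mP; exact: measurableC.
  + by rewrite -setIUl preimage_setC setUCr setTI; exact: measurable_int (iP _ mB).
  + by rewrite disj_set2E setIACA preimage_setC setICr set0I.
- move=> F tF mF.
  split; first by apply: bigcup_measurable => k _; exact: (mF k).1.
  rewrite preimage_bigcup setI_bigcupl integral_bigcup.
  + by rewrite eseries0// => i _ _; exact: (mF i).2.
  + apply/trivIsetP => i j _ _ ij; rewrite setIACA -preimage_setI.
    by move/trivIsetP : tF => -> //; rewrite preimage_set0 set0I.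
  + by move=> k; apply: mP; exact: (mF k).1.
  + by apply: iP; apply: bigcup_measurable => k _; apply: mP; exact: (mF k).1.
Qed.

Lemma integral_eq_subset d (T : measurableType d) (R : realType)
    (mu : {measure set T -> \bar R}) (A B : set T) (f : T -> \bar R) :
  B `<=` A -> (forall x, A x -> ~ B x -> f x = 0) ->
  \int[mu]_(x in A) f x = \int[mu]_(x in B) f x.
Proof.
move=> BA AB; rewrite (integral_mkcond A) (integral_mkcond B).
apply: eq_integral => x _; rewrite /patch.
case: ifPn; case: ifPn => //; rewrite !(inE, notin_setE) => xB xA.
  by rewrite AB.
by case: xA; exact: BA.
Qed.

Lemma ae_weaken d (T : measurableType d) (R : realType)
    (mu : {measure set T -> \bar R}) (P Q : T -> Prop) :
  (forall x, P x -> Q x) -> {ae mu, forall x, P x} -> {ae mu, forall x, Q x}.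
Proof. by move=> PQ; apply: filterS. Qed.

Lemma ae_and d (T : measurableType d) (R : realType)
    (mu : {measure set T -> \bar R}) (P Q : T -> Prop) :
  {ae mu, forall x, P x} -> {ae mu, forall x, Q x} ->
  {ae mu, forall x, P x /\ Q x}.
Proof. by move=> hP hQ; apply: filterS2 hP hQ. Qed.

End ZeroIntegrals.

(** * Functions whose integrals over all quadrants vanish *)

Section PlaneMeasure.
Context {R : realType}.
Notation mu := (@lebesgue_measure R).
Notation mu2 := (mu \x mu)%E.

Definition upper_quadrant (c d : R) : set (R * R) :=
  [set z | c < z.1 /\ d < z.2].

(** Since [f] vanishes where a coordinate is at most [a], half-planes and the whole plane can be
    replaced by quadrants with a corner coordinate [a], so that quadrants suffice as generators. *)
Lemma integral_quadrants_ae_eq0 (f : R * R -> R) (a : R) :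
  mu2.-integrable setT (EFin \o f) ->
  (forall z, z.1 <= a \/ z.2 <= a -> f z = 0) ->
  (forall c d, (\int[mu2]_(z in upper_quadrant c d) (f z)%:E = 0)%E) ->
  {ae mu2, forall z, f z = 0}.
Proof.
move=> fi fa0 fq.
pose G : set (set R) := [set A | A = setT \/ exists c, A = `]c, +oo[%classic].
have IG : setI_closed G.
  move=> A B [->|[c ->]] [->|[d ->]].
  - by rewrite setIT; left.
  - by rewrite setTI; right; exists d.
  - by rewrite setIT; right; exists c.
  - right; exists (Num.max c d); apply/seteqP; split => x /=;
      rewrite !in_itv/= !andbT gt_max; [by case=> -> ->|by case/andP].
have mG : (@measurable _ (measurableTypeR R)) = <<s G >>.
  rewrite [LHS](RGenOInfty.measurableE R); apply/seteqP; split; apply: smallest_sub.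
  - exact: smallest_sigma_algebra.
  - by move=> _ [c ->]; apply: sub_sigma_algebra; right; exists c.
  - exact: smallest_sigma_algebra.
  - move=> _ [->|[c ->]]; first exact: measurableT.
    by apply: sub_sigma_algebra; exists c.
have m1 := @measurable_fst _ _ (measurableTypeR R) (measurableTypeR R).
have m2 := @measurable_snd _ _ (measurableTypeR R) (measurableTypeR R).
set p1 := fst in m1; set p2 := snd in m2.
have strict c (pi : (measurableTypeR R * measurableTypeR R)%type -> measurableTypeR R) :
    measurable_fun setT pi -> measurable [set z | c < pi z].
  move=> mpi; rewrite (_ : mkset _ = pi @^-1` `]c, +oo[%classic).
    by rewrite -[X in measurable X]setTI; apply: mpi.
  by apply/seteqP; split => z /=; rewrite in_itv/= andbT.
(* The sides of a rectangle become arbitrary one at a time, the first here and the second in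
   [stepB]; [stepC] passes from rectangles to all measurable sets. *)
have stepA d A : measurable A ->
    (\int[mu2]_(z in p1 @^-1` A `&` [set z | d < p2 z]%R) (f z)%:E = 0)%E.
  have h0 : (\int[mu2]_(z in [set z | d < p2 z]%R) (f z)%:E = 0)%E.
    rewrite -(fq a d); apply: integral_eq_subset.
      by move=> z [].
    move=> z h1 h2; congr EFin; apply: fa0; left; rewrite leNgt; apply/negP => h3.
    exact: h2.
  apply: (integral_preimage_eq0 m1 (strict d _ m2) fi IG mG) => //.
  move=> {}A [->|[c ->]]; first by rewrite preimage_setT setTI.
  rewrite -[RHS](fq c d); congr (integral _ _ _).
  by apply/seteqP; split => z /=; rewrite in_itv/= andbT.
have stepB A B : measurable A -> measurable B ->
    (\int[mu2]_(z in p2 @^-1` B `&` p1 @^-1` A) (f z)%:E = 0)%E.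
  move=> mA; move: B.
  have mA1 : measurable (p1 @^-1` A).
    by rewrite -[X in measurable X]setTI; exact: m1.
  apply: (integral_preimage_eq0 m2 mA1 fi IG mG).
    rewrite -(stepA a A mA); apply: integral_eq_subset => //.
    move=> z h1 h2; congr EFin; apply: fa0; right; rewrite leNgt; apply/negP => h3.
    exact: h2.
  move=> B [->|[c ->]].
    rewrite preimage_setT setTI -(stepA a A mA); apply: integral_eq_subset => //.
    move=> z h1 h2; congr EFin; apply: fa0; right; rewrite leNgt; apply/negP => h3.
    exact: h2.
  rewrite setIC -(stepA c A mA); congr (integral _ _ _); congr (_ `&` _).
  by apply/seteqP; split => z /=; rewrite in_itv/= andbT.
pose H : set (set (R * R)) :=
  [set C | exists A B : set (measurableTypeR R),
    [/\ measurable A, measurable B & C = A `*` B]].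
have stepC A : measurable A -> (\int[mu2]_(z in id @^-1` A `&` setT) (f z)%:E = 0)%E.
  apply: (integral_preimage_eq0 (G := H) _ _ fi) => //.
  - move=> _ _ [A1 [B1 [? ? ->]]] [A2 [B2 [? ? ->]]]; rewrite -setXI.
    by exists (A1 `&` A2), (B1 `&` B2); split=> //; exact: measurableI.
  - rewrite measurable_prod_measurableType; congr (<<s _ >>).
    apply/seteqP; split => [_ [X mX [Y mY <-]]|_ [X [Y [mX mY ->]]]].
      by exists X, Y.
    by exists X => //; exists Y.
  - by rewrite -(stepB setT setT) // preimage_setT setIT.
  - move=> _ [X [Y [mX mY ->]]]; rewrite -(stepB X Y mX mY).
    by congr (integral _ _ _); rewrite setIT setIC.
have := @integral_ae_eq _ _ _ mu2 setT measurableT (cst 0%E) (EFin \o f) fi.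
move=> /(_ (measurable_cst _)) h.
have : ae_eq mu2 setT (EFin \o f) (cst 0%E).
  apply: h => E _ mE; rewrite integral0.
  by rewrite -(stepC E mE) setIT.
by apply: filterS => z /(_ I) [].
Qed.

End PlaneMeasure.

Lemma Rintegral_eq_subset d (T : measurableType d) (R : realType)
    (mu : {measure set T -> \bar R}) (A B : set T) (f : T -> R) :
  B `<=` A -> (forall x, A x -> ~ B x -> f x = 0) ->
  \int[mu]_(x in A) f x = \int[mu]_(x in B) f x.
Proof.
move=> BA AB; congr fine; apply: integral_eq_subset => // x Ax Bx.
by rewrite AB.
Qed.

(** * Weak derivatives tested on tensor products *)

Section WeakDerivatives.
Context {R : realType}.
Notation RR := (measurableTypeR R * measurableTypeR R)%type.
Notation mu := (@lebesgue_measure R).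
Notation mu2 := (mu \x mu)%E.
Implicit Types (u v e : R * R -> R) (f g : R -> R) (r : R).

Definition square (r : R) : set (R * R) := [set z | `|z.1| <= r /\ `|z.2| <= r].

Lemma squareE r : square r = `[- r, r]%classic `*` `[- r, r]%classic.
Proof.
by apply/seteqP; split => z; rewrite /square/= !in_itv/= -!ler_norml => -[].
Qed.

Lemma compact_square r : compact (square r).
Proof. by rewrite squareE; apply: compact_setX; exact: segment_compact. Qed.

Lemma measurable_square r : measurable (square r : set RR).
Proof. by rewrite squareE; apply: measurableX; exact: measurable_itv. Qed.

Lemma mu2_square_lty r : (mu2 (square r) < +oo)%E.
Proof.
rewrite squareE product_measure1E; [|exact: measurable_itv..].
rewrite -[X in (X < _)%E]/(mu _ * mu _)%E !lebesgue_measure_itv/=.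
by case: ifP => _; rewrite ?mule0 ?ltry// -EFinM ltry.
Qed.

Lemma smooth1_continuous f : smooth1 f -> continuous f.
Proof.
move=> /smooth1_derive[f' _ df] x.
apply: differentiable_continuous; apply/derivable1_diffP; exact: ex_derive.
Qed.

Lemma continuous_bounded_itv f r : continuous f ->
  exists2 C : R, 0 <= C & forall x, `|x| <= r -> `|f x| <= C.
Proof.
move=> cf.
have /compact_bounded[M [_ /(_ (Num.max M 0 + 1))]] : compact (f @` `[- r, r]).
  apply: continuous_compact; last exact: segment_compact.
  exact: continuous_subspaceT.
have M1 : M < Num.max M 0 + 1 by rewrite ltr_pwDr// le_max lexx.
move=> /(_ M1) h.
exists (Num.max M 0 + 1) => [|x xr]; first by rewrite addr_ge0// le_max lexx orbT.
by apply: h; exists x => //=; rewrite in_itv/= -ler_norml.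
Qed.

Lemma measurable_tensor f g : continuous f -> continuous g ->
  measurable_fun [set: RR] (tensor f g).
Proof.
move=> cf cg; apply: measurable_funM.
  apply: (measurableT_comp (continuous_measurable_fun cf)).
  exact: (@measurable_fst _ _ (measurableTypeR R) (measurableTypeR R)).
apply: (measurableT_comp (continuous_measurable_fun cg)).
exact: (@measurable_snd _ _ (measurableTypeR R) (measurableTypeR R)).
Qed.

Lemma integrable_tensorM v f g r : continuous f -> continuous g ->
    mu2.-integrable (square r) (EFin \o v) ->
  mu2.-integrable (square r) (EFin \o (fun z => v z * tensor f g z)).
Proof.
move=> cf cg iv.
have := @integrableMl _ _ _ mu2 _ (measurable_square r) _ (tensor f g) iv.
apply.
  apply: measurable_funTS; exact: measurable_tensor.
have [C C0 fC] := continuous_bounded_itv r cf.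
have [D D0 gD] := continuous_bounded_itv r cg.
exists (C * D); split; first exact: num_real.
move=> x Cx z [z1 z2] /=; rewrite (le_trans _ (ltW Cx))// normrM.
by apply: ler_pM => //; [exact: fC|exact: gD].
Qed.

(** The squared distance to a corner is 98/25, below 4. *)
Lemma square_disc : square (7 / 5) `<=` @disc R.
Proof.
move=> z [z1 z2]; rewrite /disc/=.
have h (x : R) : `|x| <= 7 / 5 -> x ^+ 2 <= 49 / 25.
  move=> hx; rewrite -real_normK ?num_real// (_ : 49 / 25 = (7 / 5) ^+ 2); last by field.
  by rewrite lerXn2r// nnegrE; lra.
have := h _ z1; have := h _ z2; lra.
Qed.

(** The factors vanish off [-7/5, 7/5], so the tensor product is a test function on [disc] and both
    integrals reduce to the square. *)
Lemma weak_derivative_tensor (a b : bool) u v f g f' g' :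
    smooth1 f -> smooth1 g -> smooth1 g' ->
    (forall x, is_derive x (1 : R) f (f' x)) ->
    (forall x, is_derive x (1 : R) g (g' x)) ->
    (forall x, 7 / 5 < `|x| -> f x = 0 /\ (if a then f' else f) x = 0) ->
    (forall x, 7 / 5 < `|x| -> g x = 0 /\ (if b then g' else g) x = 0) ->
    is_weak_derivative disc a b u v ->
  \int[mu2]_(z in square (7 / 5))
    (u z * tensor (if a then f' else f) (if b then g' else g) z) =
  (-1) ^+ (a + b) * \int[mu2]_(z in square (7 / 5)) (v z * tensor f g z).
Proof.
move=> Sf Sg Sg' df dg f0 g0 [_ _ huv].
have t0 h k z : (forall x, 7 / 5 < `|x| -> h x = 0) ->
    (forall x, 7 / 5 < `|x| -> k x = 0) -> ~ square (7 / 5) z -> tensor h k z = 0 :> R.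
  move=> h0 k0 zs; rewrite /tensor.
  have [z1|z1] := ltP (7 / 5) `|z.1|; first by rewrite h0// mul0r.
  have [z2|z2] := ltP (7 / 5) `|z.2|; first by rewrite k0// mulr0.
  by exfalso; exact: zs.
have tfg : test_function disc (tensor f g).
  split; first exact/smooth_on_sepfun/sepfun_tensor.
  exists (square (7 / 5)); split; [exact: compact_square|exact: square_disc|].
  by move=> z; apply: t0 => x /[dup] /f0[? ?] /g0[].
have := huv _ tfg; rewrite (partial_tensor a b Sg' df dg) => h.
have E w h1 k1 : (forall x, 7 / 5 < `|x| -> h1 x = 0) ->
    (forall x, 7 / 5 < `|x| -> k1 x = 0) ->
    \int[lebesgue2]_(z in disc) (w z * tensor h1 k1 z) =
    \int[mu2]_(z in square (7 / 5)) (w z * tensor h1 k1 z) :> R.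
  move=> h0 k0; apply: Rintegral_eq_subset; first exact: square_disc.
  by move=> z _ zs; rewrite t0// mulr0.
rewrite -!E//; try by move=> x /[dup] /f0[? ?] /g0[].
Qed.

End WeakDerivatives.

(** * The cut-off and the mixed derivative of the cut-off function *)

Section CutOff.
Context {R : realType}.
Notation RR := (measurableTypeR R * measurableTypeR R)%type.
Notation mu := (@lebesgue_measure R).
Notation mu2 := (mu \x mu)%E.
Implicit Types (u v e : R * R -> R) (f g P Q : R -> R) (r : R).

Definition cutoff (x : R) : R := flat 0 (x + 7 / 5) * flat 0 (7 / 5 - x).

(** [flat 2] is the derivative of [flat 0]: the other term in [is_derive_flat] has the factor [k],
    here 0. *)
Definition cutoff' (x : R) : R :=
  flat 2 (x + 7 / 5) * flat 0 (7 / 5 - x) - flat 0 (x + 7 / 5) * flat 2 (7 / 5 - x).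

Lemma smooth1_shift f r : smooth1 f -> smooth1 (fun x => f (x + r)).
Proof.
move=> /(smooth1_affine 1 r); congr smooth1; apply/funext => x.
by rewrite mul1r.
Qed.

Lemma smooth1_refl f r : smooth1 f -> smooth1 (fun x => f (r - x)).
Proof.
move=> /(smooth1_affine (-1) r); congr smooth1; apply/funext => x.
by rewrite mulN1r addrC.
Qed.

Lemma smooth1B f g : smooth1 f -> smooth1 g -> smooth1 (fun x => f x - g x).
Proof.
move=> Sf Sg; have := smooth1D Sf (smooth1M (smooth1_cst (-1)) Sg).
by congr smooth1; apply/funext => x; rewrite mulN1r.
Qed.

Lemma smooth1_cutoff : smooth1 cutoff.
Proof.
by apply: smooth1M; [apply: smooth1_shift|apply: smooth1_refl]; exact: smooth1_flat.
Qed.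

Lemma smooth1_cutoff' : smooth1 cutoff'.
Proof.
apply: smooth1B; apply: smooth1M; try (by apply: smooth1_shift; exact: smooth1_flat);
  by apply: smooth1_refl; exact: smooth1_flat.
Qed.

Lemma is_derive_shift f (f' r x : R) : is_derive (x + r) (1 : R) f f' ->
  is_derive x (1 : R) (fun y => f (y + r)) f'.
Proof.
move=> df; apply: is_derive_eq (_ : is_derive x 1 _ (f' * 1)) _; last exact: mulr1.
apply: (@is_derive1_comp _ f (fun y => y + r)).
by apply: is_derive_eq (is_deriveD (is_derive_id x (1 : R)) (is_derive_cst r x (1 : R))) _; rewrite addr0.
Qed.

Lemma is_derive_refl f (f' r x : R) : is_derive (r - x) (1 : R) f f' ->
  is_derive x (1 : R) (fun y => f (r - y)) (- f').
Proof.
move=> df; apply: is_derive_eq (_ : is_derive x 1 _ (f' * -1)) _; last exact: mulrN1.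
apply: (@is_derive1_comp _ f (fun y => r - y)).
by apply: is_derive_eq (is_deriveB (is_derive_cst r x (1 : R)) (is_derive_id x (1 : R))) _; rewrite sub0r.
Qed.

Lemma is_derive_flat0 (x : R) : is_derive x (1 : R) (flat 0) (flat 2 x).
Proof. by apply: is_derive_eq (is_derive_flat 0 x) _; rewrite mul0r subr0. Qed.

Lemma is_derive_cutoff (x : R) : is_derive x (1 : R) cutoff (cutoff' x).
Proof.
apply: is_derive_eq (is_deriveM (is_derive_shift (is_derive_flat0 _))
  (is_derive_refl (is_derive_flat0 _))) _.
by rewrite /cutoff' -[LHS]/(_ * _ + _ * _); ring.
Qed.

Lemma cutoff_eq0 (x : R) : 7 / 5 < `|x| -> cutoff x = 0 /\ cutoff' x = 0.
Proof.
rewrite /cutoff /cutoff' lter_normr => /orP[] h.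
  by rewrite ![flat _ (7 / 5 - x)]flat_le0 ?mulr0 ?subr0//; lra.
by rewrite ![flat _ (x + 7 / 5)]flat_le0 ?mul0r ?subr0//; lra.
Qed.

(** The Leibniz expansion of the derivative of order (1, 1) of u times the product cut-off, with
    [e00], [e10], [e01], [e11] standing for the weak derivatives of u. *)
Definition cut_density e00 e10 e01 e11 (z : R * R) : R :=
  e11 z * tensor cutoff cutoff z + e10 z * tensor cutoff cutoff' z +
  e01 z * tensor cutoff' cutoff z + e00 z * tensor cutoff' cutoff' z.

Lemma Rintegral_sum4 d (T : measurableType d) (nu : {measure set T -> \bar R})
    (D : set T) (f1 f2 f3 f4 : T -> R) : measurable D ->
  nu.-integrable D (EFin \o f1) -> nu.-integrable D (EFin \o f2) ->
  nu.-integrable D (EFin \o f3) -> nu.-integrable D (EFin \o f4) ->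
  \int[nu]_(x in D) (f1 x + f2 x + f3 x + f4 x) =
  \int[nu]_(x in D) f1 x + \int[nu]_(x in D) f2 x +
  \int[nu]_(x in D) f3 x + \int[nu]_(x in D) f4 x.
Proof.
move=> mD i1 i2 i3 i4.
have i12 : nu.-integrable D (EFin \o (fun x => f1 x + f2 x)) by exact: (integrableD mD i1 i2).
have i123 : nu.-integrable D (EFin \o (fun x => f1 x + f2 x + f3 x)) by exact: (integrableD mD i12 i3).
by rewrite !RintegralD.
Qed.

(** This says weakly that [cut_density] is the mixed derivative of the cut-off u: integrating by
    parts once in each variable moves it to the product of P(7/5) - P and Q(7/5) - Q, whose mixed
    derivative is P' Q'. The cut-off supplies the compact support that these factors lack. *)
Lemma Rintegral_weak_tensor u e00 e10 e01 e11 P P' Q Q' :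
    is_weak_derivative disc 0 0 u e00 -> is_weak_derivative disc 1 0 u e10 ->
    is_weak_derivative disc 0 1 u e01 -> is_weak_derivative disc 1 1 u e11 ->
    smooth1 P -> smooth1 P' -> (forall x, is_derive x (1 : R) P (P' x)) ->
    smooth1 Q -> smooth1 Q' -> (forall x, is_derive x (1 : R) Q (Q' x)) ->
  \int[mu2]_(z in square (7 / 5)) (u z * tensor cutoff cutoff z * tensor P' Q' z) =
  \int[mu2]_(z in square (7 / 5)) (cut_density e00 e10 e01 e11 z *
     tensor (fun x => P (7 / 5) - P x) (fun x => Q (7 / 5) - Q x) z).
Proof.
move=> w00 w10 w01 w11 SP SP' dP SQ SQ' dQ.
have iK v e a b : is_weak_derivative disc a b v e ->
    mu2.-integrable (square (7 / 5)) (EFin \o v) /\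
    mu2.-integrable (square (7 / 5)) (EFin \o e).
  move=> [lv le _]; split; [apply: lv|apply: le];
    by [exact: compact_square|exact: square_disc].
have [iu i00] := iK _ _ _ _ w00; have [_ i10] := iK _ _ _ _ w10.
have [_ i01] := iK _ _ _ _ w01; have [_ i11] := iK _ _ _ _ w11.
(* The constants are chosen so that both primitives vanish at the right end 7/5; for limits of ramps
   they then become lengths of intervals. *)
pose A := fun x => P (7 / 5) - P x; pose B := fun x => Q (7 / 5) - Q x.
have SA : smooth1 A by apply: smooth1B => //; exact: smooth1_cst.
have SB : smooth1 B by apply: smooth1B => //; exact: smooth1_cst.
have dA (F F' : R -> R) : (forall x, is_derive x (1 : R) F (F' x)) ->
  forall x, is_derive x (1 : R) (fun x => cutoff x * (F (7 / 5) - F x))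
   (cutoff' x * (F (7 / 5) - F x) - cutoff x * F' x).
  move=> dF x.
  apply: is_derive_eq (is_deriveM (is_derive_cutoff x)
    (is_deriveB (is_derive_cst (F (7 / 5)) x (1 : R)) (dF x))) _.
  by rewrite -[LHS]/(cutoff x * (0 - F' x) + (F (7 / 5) - F x) * cutoff' x); ring.
pose f x := cutoff x * A x; pose f' x := cutoff' x * A x - cutoff x * P' x.
pose g x := cutoff x * B x; pose g' x := cutoff' x * B x - cutoff x * Q' x.
pose f1 x := cutoff' x * A x; pose g1 x := cutoff' x * B x.
have Sf : smooth1 f by apply: smooth1M => //; exact: smooth1_cutoff.
have Sg : smooth1 g by apply: smooth1M => //; exact: smooth1_cutoff.
have Sf1 : smooth1 f1 by apply: smooth1M => //; exact: smooth1_cutoff'.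
have Sg1 : smooth1 g1 by apply: smooth1M => //; exact: smooth1_cutoff'.
have Sf' : smooth1 f' by apply: smooth1B => //; apply: smooth1M => //; exact: smooth1_cutoff.
have Sg' : smooth1 g' by apply: smooth1B => //; apply: smooth1M => //; exact: smooth1_cutoff.
have df : forall x, is_derive x (1 : R) f (f' x) by exact: dA.
have dg : forall x, is_derive x (1 : R) g (g' x) by exact: dA.
have [f1' Sf1' df1] := smooth1_derive Sf1.
have [g1' Sg1' dg1] := smooth1_derive Sg1.
have c := smooth1_continuous.
have E00 := @weak_derivative_tensor _ false false _ _ _ _ _ _ Sf1 Sg1 Sg1' df1 dg1 _ _ w00.
have E10 := @weak_derivative_tensor _ true false _ _ _ _ _ _ Sf Sg1 Sg1' df dg1 _ _ w10.
have E01 := @weak_derivative_tensor _ false true _ _ _ _ _ _ Sf1 Sg Sg' df1 dg _ _ w01.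
have E11 := @weak_derivative_tensor _ true true _ _ _ _ _ _ Sf Sg Sg' df dg _ _ w11.
(* The cut-off times P' is f1 - f', and times Q' it is g1 - g'. Of the four products, each is a test
   derivative of a different order: (1, 1), (1, 0), (0, 1) and (0, 0). *)
transitivity (\int[mu2]_(z in square (7 / 5)) (u z * tensor f' g' z + (- u z) * tensor f' g1 z
   + (- u z) * tensor f1 g' z + u z * tensor f1 g1 z)).
  by apply: eq_Rintegral => z _; rewrite /tensor /f' /g' /f1 /g1; ring.
have iN : mu2.-integrable (square (7 / 5)) (EFin \o (fun z => - u z)).
  exact: (integrableN iu).
rewrite Rintegral_sum4; [|exact: measurable_square|apply: integrable_tensorM => //; exact: c..].
transitivity (\int[mu2]_(z in square (7 / 5)) (e11 z * tensor f g z + e10 z * tensor f g1 z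
   + e01 z * tensor f1 g z + e00 z * tensor f1 g1 z)); last first.
  by apply: eq_Rintegral => z _; rewrite /cut_density /tensor /f /g /f1 /g1 /A /B; ring.
rewrite Rintegral_sum4; [|exact: measurable_square|apply: integrable_tensorM => //; exact: c..].
have N h k : continuous h -> continuous k -> \int[mu2]_(z in square (7 / 5)) (- u z * tensor h k z) =
    - \int[mu2]_(z in square (7 / 5)) (u z * tensor h k z).
  move=> ch ck; rewrite -mulN1r -RintegralZl; [|exact: measurable_square|exact: integrable_tensorM].
  by apply: eq_Rintegral => z _; rewrite mulN1r mulNr.
rewrite !N; try exact: c.
rewrite E00 ?E10 ?E01 ?E11 /=; first by rewrite expr0 expr1 sqrrN expr1n; ring.
all: by move=> x /cutoff_eq0[c1 c2]; rewrite /f /f' /g /g' /f1 /g1 ?c1 ?c2 !mul0r ?subr0.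
Qed.

End CutOff.

(** * Smooth approximation of the indicator of a half-line *)

Section Ramp.
Context {R : realType}.
Implicit Types (x c y : R) (n : nat).

(* ramp n c tends to max(x - c, 0), with derivative between 0 and 1. *)
Definition ramp n c x : R := (x - c) * flat 0 (n.+1%:R * (x - c)).

Definition ramp' n c x : R :=
  flat 0 (n.+1%:R * (x - c)) + flat 1 (n.+1%:R * (x - c)).

Lemma smooth1_scale f (a c : R) : smooth1 f -> smooth1 (fun x => f (a * (x - c))).
Proof.
move=> /(smooth1_affine a (- (a * c))); congr smooth1; apply/funext => x.
by rewrite mulrBr.
Qed.

Lemma smooth1_ramp n c : smooth1 (ramp n c).
Proof.
apply: smooth1M; last by apply: smooth1_scale; exact: smooth1_flat.
by apply: smooth1B; [exact: smooth1_id|exact: smooth1_cst].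
Qed.

Lemma smooth1_ramp' n c : smooth1 (ramp' n c).
Proof. by apply: smooth1D; apply: smooth1_scale; exact: smooth1_flat. Qed.

Lemma is_derive_ramp n c x : is_derive x (1 : R) (ramp n c) (ramp' n c x).
Proof.
have d1 : is_derive x (1 : R) (fun y => y - c) 1.
  by apply: is_derive_eq (is_deriveB (is_derive_id x (1 : R)) (is_derive_cst c x (1 : R))) _; rewrite subr0.
have d2 : is_derive x (1 : R) (fun y => n.+1%:R * (y - c)) n.+1%:R.
  by apply: is_derive_eq (is_deriveZ n.+1%:R d1) _; rewrite [_ *: _]mulr1.
apply: is_derive_eq (is_deriveM d1
  (@is_derive1_comp _ (flat 0) (fun y => n.+1%:R * (y - c)) _ _ _ (is_derive_flat0 _) d2)) _.
rewrite /= /ramp'; set y := n.+1%:R * (x - c).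
rewrite -[LHS]/((x - c) * (flat 2 y * n.+1%:R) + flat 0 y * 1).
rewrite mulr1 addrC; congr (_ + _).
(* The factor [n.+1%:R] of the chain rule turns x - c into y, and y times [flat 2 y] is
   [flat 1 y]. *)
rewrite mulrC -mulrA -/y /flat; case: ifP => [y0|_]; last by rewrite mul0r.
by field; rewrite gt_eqF.
Qed.

(** For y > 0 the sum is (1 + 1/y) exp(-1/y), and exp t is at least 1 + t. *)
Lemma flat01_itv y : 0 <= flat 0 y + flat 1 y <= 1.
Proof.
rewrite addr_ge0 ?flat_ge0//= /flat; case: ifP => [y0|_]; last by rewrite addr0 ler01.
rewrite expr0 invr1 -mulrDl expRN ler_pdivrMr ?expR_gt0// mul1r expr1.
exact: expR_ge1Dx.
Qed.

Lemma ramp'_itv n c x : 0 <= ramp' n c x <= 1.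
Proof. exact: flat01_itv. Qed.

Lemma flat_le1 y : flat 0 y <= 1.
Proof. by have /andP[_] := flat01_itv y; apply: le_trans; rewrite lerDl flat_ge0. Qed.

Lemma cvg_flat_pos k (y : R) : 0 < y ->
  flat k (n.+1%:R * y) @[n --> \oo] --> ((k == 0%N)%:R : R).
Proof.
move=> y0.
have cv : (n.+1%:R * y)^-1 @[n --> \oo] --> (0 : R).
  rewrite (_ : (fun n => (n.+1%:R * y)^-1) = (fun n => y^-1 * n.+1%:R^-1)); last first.
    by apply/funext => n; rewrite invfM mulrC.
  by rewrite -[X in _ --> X](mulr0 y^-1); apply: cvgMr; exact: cvg_harmonic.
rewrite (_ : (fun n => flat k _) = (fun n => (n.+1%:R * y)^-1 ^+ k * expR (- (n.+1%:R * y)^-1))); last first.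
  by apply/funext => n; rewrite /flat mulr_gt0// exprVn.
rewrite (_ : (k == 0%N)%:R = (0 : R) ^+ k * expR (- 0)); last first.
  by rewrite oppr0 expR0 mulr1 expr0n.
apply: cvgM.
  apply: (@continuous_cvg _ _ _ _ _ _ (fun y : R => y ^+ k)) => //.
  exact: exprn_continuous.
apply: (@continuous_cvg _ _ _ _ _ _ expR); first exact: continuous_expR.
exact: cvgN.
Qed.

Lemma cvg_ramp' c x : ramp' n c x @[n --> \oo] --> (if c < x then 1 else 0 : R).
Proof.
case: ifPn => [cx|]; last first.
  rewrite -leNgt => xc; rewrite /ramp'.
  rewrite (_ : (fun n => _) = cst 0); first exact: cvg_cst.
  by apply/funext => n; rewrite !flat_le0 ?addr0// mulr_ge0_le0// subr_le0.
rewrite -[X in _ --> X]addr0.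
have xc : 0 < x - c by rewrite subr_gt0.
rewrite /ramp'; apply: (@cvgD _ _ _ _ _ (fun n => flat 0 (n.+1%:R * (x - c)))).
  by exact: (@cvg_flat_pos 0 _ xc).
exact: (@cvg_flat_pos 1 _ xc).
Qed.

Lemma cvg_ramp c x : ramp n c x @[n --> \oo] --> Num.max (x - c) 0.
Proof.
rewrite /ramp; have [xc|xc] := leP (x - c) 0.
  rewrite (_ : (fun n => _) = cst 0); first exact: cvg_cst.
  by apply/funext => n; rewrite flat_le0 ?mulr0// mulr_ge0_le0.
rewrite -[X in _ --> X]mulr1; apply: cvgMr.
by exact: (@cvg_flat_pos 0 _ xc).
Qed.

Lemma ramp_le n c x : `|ramp n c x| <= `|x - c|.
Proof.
rewrite /ramp normrM -[leRHS]mulr1 ler_wpM2l// ger0_norm ?flat_ge0//.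
exact: flat_le1.
Qed.

End Ramp.

Lemma cvg_Rintegral_bounded d (T : measurableType d) (R : realType)
    (mu : {measure set T -> \bar R}) (D : set T) (v : T -> R)
    (phi_ : nat -> T -> R) (phi : T -> R) (C : R) :
  measurable D -> mu.-integrable D (EFin \o v) ->
  (forall n, measurable_fun D (phi_ n)) ->
  (forall n x, D x -> `|phi_ n x| <= C) ->
  (forall x, D x -> phi_ n x @[n --> \oo] --> phi x) ->
  mu.-integrable D (EFin \o (fun x => v x * phi x)) /\
  \int[mu]_(x in D) (v x * phi_ n x) @[n --> \oo] --> \int[mu]_(x in D) (v x * phi x).
Proof.
move=> mD iv mphi_ bphi cphi.
have mphi : measurable_fun D phi by apply: (measurable_fun_cvg mphi_).
have mv : measurable_fun D v by apply/measurable_EFinP; exact: measurable_int iv.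
have m1 n : measurable_fun D (EFin \o (fun x => v x * phi_ n x)).
  by apply/measurable_EFinP; apply: measurable_funM.
have m2 : measurable_fun D (EFin \o (fun x => v x * phi x)).
  by apply/measurable_EFinP; apply: measurable_funM.
have c1 : {ae mu, forall x, D x ->
    (v x * phi_ n x)%:E @[n --> \oo] --> (v x * phi x)%:E}.
  apply: aeW => x Dx /=; apply/cvg_EFin; first exact: nearW.
  by apply: cvgMr; exact: cphi.
have i0 : mu.-integrable D (fun x => (`|v x| * C)%:E).
  exact: (integrableZr mD C (integrable_norm iv)).
have le : {ae mu, forall x n, D x -> (`|(v x * phi_ n x)%:E| <= (`|v x| * C)%:E)%E}.
  apply: aeW => x n Dx /=; rewrite lee_fin normrM ler_wpM2l//.
  exact: bphi.
have [i1 _ h] := dominated_convergence mD m1 m2 c1 i0 le.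
split=> //; apply: fine_cvg; rewrite fineK; last exact: integrable_fin_num.
exact: h.
Qed.

(** * The integral of the cut-off function over a quadrant *)

Section QuadrantIdentity.
Context {R : realType}.
Notation RR := (measurableTypeR R * measurableTypeR R)%type.
Notation mu := (@lebesgue_measure R).
Notation mu2 := (mu \x mu)%E.
Implicit Types (u v e : R * R -> R) (f g P Q : R -> R) (r : R).

Lemma integrable_cut_density e00 e10 e01 e11 :
  mu2.-integrable (square (7 / 5)) (EFin \o e00) ->
  mu2.-integrable (square (7 / 5)) (EFin \o e10) ->
  mu2.-integrable (square (7 / 5)) (EFin \o e01) ->
  mu2.-integrable (square (7 / 5)) (EFin \o e11) ->
  mu2.-integrable (square (7 / 5)) (EFin \o cut_density e00 e10 e01 e11).
Proof.
move=> i00 i10 i01 i11; have mK := @measurable_square R (7 / 5).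
have c := @smooth1_continuous R _ smooth1_cutoff.
have c' := @smooth1_continuous R _ smooth1_cutoff'.
have h1 := integrableD mK (integrable_tensorM c c i11) (integrable_tensorM c c' i10).
have h2 := integrableD mK h1 (integrable_tensorM c' c i01).
exact: (integrableD mK h2 (integrable_tensorM c' c' i00)).
Qed.

Lemma cvg_tensor (f_ g_ : nat -> R -> R) f g (z : R * R) :
  (forall x, f_ n x @[n --> \oo] --> f x) -> (forall x, g_ n x @[n --> \oo] --> g x) ->
  tensor (f_ n) (g_ n) z @[n --> \oo] --> tensor f g z.
Proof. by move=> cf cg; exact: cvgM. Qed.

(** The limit of [Rintegral_weak_tensor] for ramps, by dominated convergence. On the square, the
    factor max(7/5 - c, 0) - max(x - c, 0) is the length of the interval from max(c, x) to 7/5, or 0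
    if that is empty; Fubini will recognise it. *)
Lemma Rintegral_weak_quadrant u e00 e10 e01 e11 c d :
    is_weak_derivative disc 0 0 u e00 -> is_weak_derivative disc 1 0 u e10 ->
    is_weak_derivative disc 0 1 u e01 -> is_weak_derivative disc 1 1 u e11 ->
  \int[mu2]_(z in square (7 / 5)) (u z * tensor cutoff cutoff z *
     tensor (fun x => if c < x then 1 else 0) (fun y => if d < y then 1 else 0) z) =
  \int[mu2]_(z in square (7 / 5)) (cut_density e00 e10 e01 e11 z *
     tensor (fun x => Num.max (7 / 5 - c) 0 - Num.max (x - c) 0)
            (fun y => Num.max (7 / 5 - d) 0 - Num.max (y - d) 0) z).
Proof.
move=> w00 w10 w01 w11.
have mK := @measurable_square R (7 / 5).
have iK v e a b : is_weak_derivative disc a b v e ->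
    mu2.-integrable (square (7 / 5)) (EFin \o v) /\
    mu2.-integrable (square (7 / 5)) (EFin \o e).
  move=> [lv le _]; split; [apply: lv|apply: le];
    by [exact: compact_square|exact: square_disc].
have [iu i00] := iK _ _ _ _ w00; have [_ i10] := iK _ _ _ _ w10.
have [_ i01] := iK _ _ _ _ w01; have [_ i11] := iK _ _ _ _ w11.
have cc := @smooth1_continuous R.
have iv := integrable_tensorM (cc _ smooth1_cutoff) (cc _ smooth1_cutoff) iu.
have iW := integrable_cut_density i00 i10 i01 i11.
have b1 n z : square (7 / 5) z -> `|tensor (ramp' n c) (ramp' n d) z| <= 1.
  move=> _; rewrite normrM mulr_ile1//; [case/andP: (ramp'_itv n c z.1)|case/andP: (ramp'_itv n d z.2)];
    by move=> ? ?; rewrite ger0_norm.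
pose A n (c x : R) : R := ramp n c (7 / 5) - ramp n c x.
have b2 n (c' x : R) : `|x| <= 7 / 5 -> `|A n c' x| <= 14 / 5 + 2 * `|c'|.
  move=> hx; rewrite (le_trans (ler_normB _ _))//.
  rewrite (le_trans (lerD (ramp_le _ _ _) (ramp_le _ _ _)))//.
  have h1 := ler_normB (7 / 5) c'; have h2 := ler_normB x c'.
  have h3 : `|7 / 5 : R| = 7 / 5 by rewrite ger0_norm.
  lra.
have b2' n z : square (7 / 5) z -> `|tensor (A n c) (A n d) z| <=
    (14 / 5 + 2 * `|c|) * (14 / 5 + 2 * `|d|).
  by move=> [z1 z2]; rewrite normrM ler_pM//; exact: b2.
have SA n (c' : R) : smooth1 (A n c').
  by apply: smooth1B; [exact: smooth1_cst|exact: smooth1_ramp].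
have cA (c' x : R) : A n c' x @[n --> \oo] --> Num.max (7 / 5 - c') 0 - Num.max (x - c') 0.
  by apply: cvgB; exact: cvg_ramp.
have [_ c1] := cvg_Rintegral_bounded mK iv
  (fun n => measurable_funTS (measurable_tensor (cc _ (smooth1_ramp' n c)) (cc _ (smooth1_ramp' n d))))
  b1 (fun z _ => @cvg_tensor _ _ _ _ z (@cvg_ramp' R c) (@cvg_ramp' R d)).
have [_ c2] := cvg_Rintegral_bounded mK iW
  (fun n => measurable_funTS (measurable_tensor (cc _ (SA n c)) (cc _ (SA n d))))
  b2' (fun z _ => @cvg_tensor _ _ _ _ z (cA c) (cA d)).
move/cvg_lim : c1 => <- //; move/cvg_lim : c2 => <- //.
congr (lim (_ @ \oo)); apply/funext => n.
apply: (Rintegral_weak_tensor w00 w10 w01 w11); first [exact: smooth1_ramp|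
  exact: smooth1_ramp'|move=> x; exact: is_derive_ramp].
Qed.

End QuadrantIdentity.

(** * Fubini for the sections of a set *)

Section FubiniSections.
Context d d' (S : measurableType d) (T : measurableType d') (R : realType).
Variables (nu : {sigma_finite_measure set S -> \bar R})
  (mu : {sigma_finite_measure set T -> \bar R}).
Variables (w : T -> R) (E : set (S * T)) (K : set S).
Hypothesis iw : mu.-integrable setT (EFin \o w).
Hypothesis mE : measurable E.
Hypothesis mK : measurable K.
Hypothesis Koo : (nu K < +oo)%E.
Hypothesis EK : forall z, E z -> K z.1.

Let f (z : S * T) : \bar R := (w z.2 * \1_E z)%:E.

Let mw : measurable_fun setT w.
Proof. by apply/measurable_EFinP; exact: measurable_int iw. Qed.

Let mf : measurable_fun setT f.
Proof.
apply/measurable_EFinP; apply: measurable_funM.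
  exact: (measurableT_comp mw measurable_snd).
exact: measurable_indic.
Qed.

Let if_ : (nu \x mu)%E.-integrable setT f.
Proof.
apply/integrable12ltyP => //.
have le s : (\int[mu]_t `|f (s, t)| <= (\1_K s)%:E * \int[mu]_t `|(w t)%:E|)%E.
  rewrite -ge0_integralZl ?lee_fin//; last first.
    by apply: measurableT_comp => //; exact/measurable_EFinP.
  apply: ge0_le_integral => //.
  - apply: measurableT_comp => //; exact: (measurableT_comp mf (measurable_pair1 _)).
  - by apply: measurable_funeM; apply: measurableT_comp => //; exact/measurable_EFinP.
  move=> t _; rewrite /f/= -EFinM lee_fin normrM mulrC ler_wpM2r//.
  rewrite ger0_norm// !indicE; case: (boolP ((s, t) \in E)) => [|_]; last by rewrite ler0n.
  by rewrite inE => /EK /= sK; rewrite mem_set.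
apply: (@le_lt_trans _ _ (\int[nu]_s ((\1_K s)%:E * \int[mu]_t `|(w t)%:E|))%E).
  apply: ge0_le_integral => //.
  - by move=> s _; exact: integral_ge0.
  - apply: (measurable_fun_fubini_tonelli_F (abse \o f)) => //=.
    exact: measurableT_comp.
  - by apply: emeasurable_funM => //; apply/measurable_EFinP; exact: measurable_indic.
rewrite ge0_integralZr//.
- rewrite integral_indic// setIT lte_mul_pinfty ?ge0_fin_numE//.
  by have /integrableP[] := iw.
- by apply/measurable_EFinP; exact: measurable_indic.
- exact: integral_ge0.
Qed.

Let xs s : measurable (xsection E s). Proof. exact: measurable_xsection. Qed.

(** Both sides are iterated integrals of w(t) times the indicator of [E]; this product is integrable
    because [K] confines s to a set of finite measure. *)
Lemma fubini_section :
  nu.-integrable setT (EFin \o (fun s => \int[mu]_(t in xsection E s) w t)) /\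
  \int[nu]_s (\int[mu]_(t in xsection E s) w t) =
  \int[mu]_t (w t * fine (nu (ysection E t))).
Proof.
have iA A : measurable A -> mu.-integrable A (EFin \o w) by move=> mA; exact: integrableS iw.
have FE : fubini_F mu f = EFin \o (fun s => \int[mu]_(t in xsection E s) w t).
  apply/funext => s; rewrite /fubini_F /= /Rintegral fineK; last exact/integrable_fin_num/iA.
  rewrite [RHS]integral_mkcond; apply: eq_integral => t _.
  rewrite /f patchE indicE/=; have -> : ((s, t) \in E) = (t \in xsection E s).
    by apply/idP/idP; rewrite !inE /xsection/= ?inE.
  by case: ifP => _; rewrite ?mulr1 ?mulr0.
split; first by rewrite -FE; exact: integrable_fubini_F.
rewrite /Rintegral; congr fine.
rewrite (_ : (fun x => (fine _)%:E) = fubini_F mu f) //.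
rewrite integral12_prod_meas1// -integral21_prod_meas1//.
apply: eq_integral => t _; rewrite /fubini_G /f/=.
have mt : measurable (ysection E t) by exact: measurable_ysection.
have nut : (nu (ysection E t) < +oo)%E.
  apply: le_lt_trans Koo; apply: le_measure; rewrite ?inE//.
  by move=> x; rewrite /ysection/= inE => /EK.
have i1 : nu.-integrable setT (fun x => (\1_(ysection E t) x)%:E).
  apply/integrableP; split; first by apply/measurable_EFinP; exact: measurable_indic.
  rewrite (_ : (fun x => _) = (fun x => (\1_(ysection E t) x)%:E)).
    by rewrite integral_indic// setIT.
  by apply/funext => x; rewrite gee0_abs.
rewrite EFinM fineK ?ge0_fin_numE// -[X in (_ * nu X)%E]setIT -integral_indic//.
rewrite -integralZl//; apply: eq_integral => x _; rewrite -EFinM !indicE.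
by congr ((_ * (nat_of_bool _)%:R)%:E); apply/idP/idP; rewrite !inE /ysection/= ?inE.
Qed.

End FubiniSections.

Lemma measurable_set_lt d (T : measurableType d) (R : realType) (f g : T -> measurableTypeR R) :
  measurable_fun setT f -> measurable_fun setT g -> measurable [set x | f x < g x].
Proof.
move=> mf mg.
have h := @measurable_fun_ltr _ _ R setT f g mf mg.
have -> : [set x | f x < g x] = setT `&` (fun x => f x < g x) @^-1` [set true].
  by apply/seteqP; split => x /=; [|case].
exact: h.
Qed.

(** * Sigma-finiteness of the Lebesgue measure of the plane *)

Section SigmaFinitePlane.
Context {R : realType}.
Notation RR := (measurableTypeR R * measurableTypeR R)%type.

(* An alias for the Lebesgue measure of the plane: on the product measure itself
   the sigma-finite structure is masked by the one of sub-probability products. *)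
Definition plane_measure : set RR -> \bar R :=
  (@lebesgue_measure R \x @lebesgue_measure R)%E.

HB.instance Definition _ := Measure.copy plane_measure
  (@lebesgue_measure R \x @lebesgue_measure R)%E.

Lemma sigma_finite_plane_measure : sigma_finite [set: RR] plane_measure.
Proof.
exists (fun n => square n%:R) => [|n].
  apply/seteqP; split => // z _.
  pose m : R := Num.max `|z.1| `|z.2|.
  exists (Num.truncn m).+1 => //.
  have /truncn_itv/andP[_ /ltW] : 0 <= m by rewrite le_max normr_ge0.
  by rewrite ge_max => /andP[? ?]; split.
by split; [exact: measurable_square|exact: mu2_square_lty].
Qed.

HB.instance Definition _ := Measure_isSigmaFinite.Build _ _ _ plane_measure
  sigma_finite_plane_measure.

End SigmaFinitePlane.

(** * Almost everywhere equality with an iterated primitive *)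

Section Primitive.
Context {R : realType}.
Notation RR := (measurableTypeR R * measurableTypeR R)%type.
Notation mu := (@lebesgue_measure R).
Notation mu2 := (mu \x mu)%E.
Notation K := (square (7 / 5 : R)).
Implicit Types (u v e W : R * R -> R) (f g : R -> R) (r c d : R).

Definition primitive W (z : R * R) : R :=
  \int[mu2]_(s in K `&` [set s | s.1 < z.1 /\ s.2 < z.2]) W s.

(** The pairs (z, s) of the double integral obtained by integrating a primitive over a quadrant: s
    lies to the lower left of z. *)
Let under c d : set (RR * RR) :=
  [set zs | (K zs.1 /\ upper_quadrant c d zs.1) /\
            (zs.2.1 < zs.1.1 /\ zs.2.2 < zs.1.2)].

Lemma measurable_upper_quadrant c d : measurable (upper_quadrant c d : set RR).
Proof.
rewrite (_ : upper_quadrant c d = `]c, +oo[%classic `*` `]d, +oo[%classic).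
  by apply: measurableX; exact: measurable_itv.
by apply/seteqP; split => z; rewrite /upper_quadrant/= !in_itv/= !andbT.
Qed.

Let measurable_under c d : measurable (under c d).
Proof.
have m11 : measurable_fun setT (fun z : RR * RR => z.1.1).
  exact: (measurableT_comp measurable_fst measurable_fst).
have m12 : measurable_fun setT (fun z : RR * RR => z.1.2).
  exact: (measurableT_comp measurable_snd measurable_fst).
have m21 : measurable_fun setT (fun z : RR * RR => z.2.1).
  exact: (measurableT_comp measurable_fst measurable_snd).
have m22 : measurable_fun setT (fun z : RR * RR => z.2.2).
  exact: (measurableT_comp measurable_snd measurable_snd).
have -> : under c d = ((K `&` upper_quadrant c d) `*` setT) `&`
    ([set z | z.2.1 < z.1.1] `&` [set z | z.2.2 < z.1.2]).
  by apply/seteqP; split => z; rewrite /under/=; tauto.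
apply: measurableI; last by apply: measurableI; exact: measurable_set_lt.
apply: measurableX => //.
by apply: measurableI; [exact: measurable_square|exact: measurable_upper_quadrant].
Qed.

Let measure_ysection_under c d (s : RR) : K s ->
  fine (mu2 (ysection (under c d) s)) =
  tensor (fun x => Num.max (7 / 5 - c) 0 - Num.max (x - c) 0)
         (fun y => Num.max (7 / 5 - d) 0 - Num.max (y - d) 0) s.
Proof.
move=> [s1 s2].
have E : ysection (under c d) s =
  `]Num.max c s.1, 7 / 5]%classic `*` `]Num.max d s.2, 7 / 5]%classic.
  move: s1 s2; rewrite !ler_norml => /andP[h1 h2] /andP[h3 h4].
  apply/seteqP; split => z; rewrite /ysection/under/square/upper_quadrant/= inE/= !in_itv/= !gt_max !ler_norml.
    by move=> [[[/andP[? ->] /andP[? ->]] [-> ->]] [-> ->]].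
  move=> [/andP[/andP[-> l1] ->] /andP[/andP[-> l2] ->]].
  by rewrite l1 l2 !andbT; do ![split] => //; apply: ltW; [exact: le_lt_trans l1|exact: le_lt_trans l2].
have M c' x : `|x| <= 7 / 5 ->
    mu `]Num.max c' x, 7 / 5]%classic = (Num.max (7 / 5 - c') 0 - Num.max (x - c') 0)%:E.
  rewrite ler_norml => /andP[_ hx].
  rewrite lebesgue_measure_itv/= lte_fin gt_max.
  case: ifPn => [/andP[h1 h2]|].
    rewrite -EFinB; congr EFin.
    have [e1|e1] := leP c' x; have [e2|e2] := leP (7 / 5 - c') 0; have [e3|e3] := leP (x - c') 0; lra.
  rewrite negb_and -!leNgt => /orP h; congr EFin; have [e2|e2] := leP (7 / 5 - c') 0; have [e3|e3] := leP (x - c') 0; case: h => h; lra.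
rewrite E product_measure1E; [|exact: measurable_itv..].
by rewrite -[X in fine X]/(mu _ * mu _)%E !M.
Qed.

(** Exchanging the integrations over [under c d], each s is weighted by the area of the rectangle of
    points z to its upper right. *)
Lemma integral_primitive_quadrant W c d :
  mu2.-integrable K (EFin \o W) ->
  mu2.-integrable setT (EFin \o (primitive W \_ (K `&` upper_quadrant c d))) /\
  \int[mu2]_z (primitive W \_ (K `&` upper_quadrant c d)) z =
  \int[mu2]_(z in K) (W z *
     tensor (fun x => Num.max (7 / 5 - c) 0 - Num.max (x - c) 0)
            (fun y => Num.max (7 / 5 - d) 0 - Num.max (y - d) 0) z).
Proof.
move=> iW; have mK := @measurable_square R (7 / 5).
have iw : mu2.-integrable setT (EFin \o (W \_ K)).
  by rewrite -restrict_EFin; apply/(integrable_mkcond _ mK).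
have [h1 h2] := fubini_section (nu := plane_measure) (mu := plane_measure) (w := W \_ K) iw (measurable_under c d) mK
  (mu2_square_lty _) (fun z h => h.1.1).
have E : (fun z => \int[mu2]_(t in xsection (under c d) z) (W \_ K) t) =
    primitive W \_ (K `&` upper_quadrant c d).
  apply/funext => z; rewrite patchE; case: ifPn; rewrite ?inE ?notin_setE => zK.
    rewrite /primitive [RHS]Rintegral_mkcondl; congr (Rintegral _ _ _).
    case: zK => zK zq.
    by apply/seteqP; split => s; rewrite /xsection/under/= inE/= => -[].
  rewrite (_ : xsection _ _ = set0) ?Rintegral_set0//.
  by apply/seteqP; split => s //; rewrite /xsection/under/= inE/= => -[/zK].
rewrite E in h1 h2; split; first exact: h1.
rewrite h2 [RHS]Rintegral_mkcond; apply: eq_Rintegral => s _.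
rewrite !patchE; case: ifPn => [|_]; last by rewrite mul0r.
by rewrite inE => sK; rewrite measure_ysection_under.
Qed.

Lemma square_upper_quadrant z : K z -> upper_quadrant (-2) (-2) z.
Proof.
case: z => x y [] /=; rewrite /upper_quadrant/= !ler_norml => /andP[? _] /andP[? _].
by split; lra.
Qed.

(** The two sides have equal integrals over every quadrant: [Rintegral_weak_quadrant] and
    [integral_primitive_quadrant] arrive at the same expression. The value -2 below is merely a
    bound to the left of and below the square. *)
Lemma ae_eq_primitive u e00 e10 e01 e11 :
    is_weak_derivative disc 0 0 u e00 -> is_weak_derivative disc 1 0 u e10 ->
    is_weak_derivative disc 0 1 u e01 -> is_weak_derivative disc 1 1 u e11 ->
  {ae mu2, forall z, K z ->
    u z * tensor cutoff cutoff z = primitive (cut_density e00 e10 e01 e11) z}.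
Proof.
move=> w00 w10 w01 w11; have mK := @measurable_square R (7 / 5).
have iK v e a b : is_weak_derivative disc a b v e ->
    mu2.-integrable K (EFin \o v) /\ mu2.-integrable K (EFin \o e).
  move=> [lv le _]; split; [apply: lv|apply: le];
    by [exact: compact_square|exact: square_disc].
have [iu i00] := iK _ _ _ _ w00; have [_ i10] := iK _ _ _ _ w10.
have [_ i01] := iK _ _ _ _ w01; have [_ i11] := iK _ _ _ _ w11.
have iW := integrable_cut_density i00 i10 i01 i11.
set W := cut_density _ _ _ _ in iW *.
pose v z := u z * tensor cutoff cutoff z.
have iv : mu2.-integrable K (EFin \o v).
  by have c := smooth1_continuous (@smooth1_cutoff R); exact: integrable_tensorM.
have iv0 : mu2.-integrable setT (EFin \o (v \_ K)).
  by rewrite -restrict_EFin; apply/(integrable_mkcond _ mK).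
have KQ : K `&` upper_quadrant (-2) (-2) = K.
  by apply/setIidPl => z; exact: square_upper_quadrant.
have ip : mu2.-integrable setT (EFin \o (primitive W \_ K)).
  by have [+ _] := integral_primitive_quadrant (-2) (-2) iW; rewrite KQ.
pose F z := (v \_ K) z - (primitive W \_ K) z.
have iF : mu2.-integrable setT (EFin \o F) by exact: (integrableB measurableT iv0 ip).
suff : {ae mu2, forall z, F z = 0}.
  apply: ae_weaken => z Fz zK; apply/eqP; rewrite -subr_eq0; apply/eqP.
  by move: Fz; rewrite /F !patchE mem_set.
apply: (integral_quadrants_ae_eq0 (a := -2) iF) => [z hz|c d].
  rewrite /F !patchE memNset ?subrr// => /square_upper_quadrant[h1 h2].
  by move: hz; rewrite !leNgt h1 h2 => -[].
have mQ := measurable_upper_quadrant c d.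
have iFQ : mu2.-integrable (upper_quadrant c d) (EFin \o F).
  exact: integrableS iF.
rewrite -[LHS]fineK; last exact: integrable_fin_num.
congr EFin; rewrite -[LHS]/(\int[mu2]_(z in upper_quadrant c d) F z).
rewrite RintegralB//; [|exact: integrableS iv0|exact: integrableS ip].
apply/eqP; rewrite subr_eq0; apply/eqP.
have [_ h] := integral_primitive_quadrant c d iW.
rewrite -[RHS]Rintegral_mkcondl [RHS]Rintegral_mkcond h /W.
rewrite -(Rintegral_weak_quadrant c d w00 w10 w01 w11).
rewrite -Rintegral_mkcondl Rintegral_mkcondr; apply: eq_Rintegral => z _.
rewrite patchE /v /tensor; case: ifPn; rewrite ?inE ?notin_setE /upper_quadrant/=.
  by move=> [-> ->]; rewrite !mulr1.
move=> h1; case: ifPn => h2; last by rewrite mul0r mulr0.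
by case: ifPn => h3; [case: h1|rewrite !mulr0].
Qed.

End Primitive.

(** * Bounds and uniform continuity of primitives *)

Lemma ge0_le_integralT d (T : measurableType d) (R : realType)
    (mu : {measure set T -> \bar R}) (f g : T -> \bar R) :
  (forall x, 0 <= f x)%E -> (forall x, f x <= g x)%E ->
  (\int[mu]_x f x <= \int[mu]_x g x)%E.
Proof.
move=> f0 fg; have g0 x : (0 <= g x)%E := le_trans (f0 x) (fg x).
rewrite !ge0_integralTE//; apply: ereal_sup_le => _ [h /= hf <-].
exists h => //= x; exact: le_trans (fg x).
Qed.

Lemma le_Rintegral_subset d (T : measurableType d) (R : realType)
    (mu : {measure set T -> \bar R}) (A B : set T) (f : T -> R) :
  measurable A -> measurable B -> mu.-integrable B (EFin \o f) -> A `<=` B ->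
  \int[mu]_(x in A) `|f x| <= \int[mu]_(x in B) `|f x|.
Proof.
move=> mA mB iB AB.
have nB : mu.-integrable B (EFin \o (fun x => `|f x|)) by exact: (integrable_norm iB).
have nA : mu.-integrable A (EFin \o (fun x => `|f x|)) by exact: integrableS nB.
rewrite fine_le//; [exact: integrable_fin_num..|].
rewrite (integral_mkcond A) (integral_mkcond B); apply: ge0_le_integralT => x.
  by rewrite patchE; case: ifP => // _; rewrite lee_fin.
rewrite !patchE; case: ifPn => [|_]; first by rewrite inE => /AB xB; rewrite mem_set.
by case: ifP => // _; rewrite lee_fin.
Qed.

(** Only the parts of [A] and [B] inside [S] contribute; each accounts for one integral over [S]. *)
Lemma Rintegral_dist_le d (T : measurableType d) (R : realType)
    (mu : {measure set T -> \bar R}) (A B S : set T) (f : T -> R) :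
  measurable A -> measurable B -> measurable S -> mu.-integrable setT (EFin \o f) ->
  (forall x, ~ S x -> A x <-> B x) ->
  `|\int[mu]_(x in A) f x - \int[mu]_(x in B) f x| <= 2 * \int[mu]_(x in S) `|f x|.
Proof.
move=> mA mB mS fi AB.
have fE C : measurable C -> mu.-integrable C (EFin \o f) by move=> mC; exact: integrableS fi.
have split_ C : measurable C -> \int[mu]_(x in C) f x =
    \int[mu]_(x in C `&` S) f x + \int[mu]_(x in C `\` S) f x.
  move=> mC; rewrite -Rintegral_setU.
  - by rewrite setUIDK.
  - exact: measurableI.
  - exact: measurableD.
  - by apply: fE; apply: measurableU; [exact: measurableI|exact: measurableD].
  - by rewrite disj_set2E; apply/eqP/seteqP; split => // x /= [[_ ?] [_ ?]].
have ABS : A `\` S = B `\` S.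
  by apply/seteqP; split => x [xA xS]; split=> //; apply/AB.
rewrite (split_ A)// (split_ B)// ABS opprD addrACA subrr addr0.
rewrite (le_trans (ler_normB _ _))// mulr2n mulrDl !mul1r.
have h C : measurable C -> `|\int[mu]_(x in C `&` S) f x| <= \int[mu]_(x in S) `|f x|.
  move=> mC; have mCS : measurable (C `&` S) by exact: measurableI.
  rewrite (le_trans (le_normr_Rintegral mCS (fE _ mCS)))//.
  by apply: le_Rintegral_subset => //; exact: fE.
by apply: lerD; exact: h.
Qed.

Section PrimitiveBounds.
Context {R : realType}.
Notation RR := (measurableTypeR R * measurableTypeR R)%type.
Notation mu := (@lebesgue_measure R).
Notation mu2 := (mu \x mu)%E.
Notation K := (square (7 / 5 : R)).
Implicit Types (u v e W : R * R -> R) (f g : R -> R).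

Lemma flat0_le (x y : R) : x <= y -> flat 0 x <= flat 0 y.
Proof.
move=> xy; have [x0|x0] := leP x 0; first by rewrite flat_le0// flat_ge0.
have y0 := lt_le_trans x0 xy.
by rewrite /flat x0 y0 !expr0 invr1 !mul1r ler_expR lerN2 lef_pV2.
Qed.

(** Both factors of the cut-off are evaluated at points at least 7/5 - 5/4 = 3/20. *)
Lemma cutoff_ge (x : R) : `|x| <= 5 / 4 -> flat 0 (3 / 20) ^+ 2 <= cutoff x.
Proof.
rewrite ler_norml => /andP[h1 h2].
by rewrite expr2 ler_pM ?flat_ge0//; apply: flat0_le; lra.
Qed.

Lemma smooth1_lipschitz f (r : R) : smooth1 f ->
  exists2 L : R, 0 <= L & forall x y, `|x| <= r -> `|y| <= r ->
    `|f x - f y| <= L * `|x - y|.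
Proof.
move=> Sf; have [f' Sf' df] := smooth1_derive Sf.
have [L L0 hL] := continuous_bounded_itv r (smooth1_continuous Sf').
exists L => // x y; wlog yx : x y / y <= x.
  move=> h xr yr; have [yx|/ltW xy] := leP y x; first exact: h.
  by rewrite distrC (distrC x); exact: h.
move=> xr yr.
have cf : {within `[y, x], continuous f}.
  by apply: continuous_subspaceT; exact: smooth1_continuous.
have [c cyx ->] := MVT_segment yx (fun z _ => df z) cf.
rewrite normrM ler_wpM2r//; apply: hL.
move: cyx xr yr; rewrite in_itv/= !ler_norml => /andP[h1 h2] /andP[h3 h4] /andP[h5 h6].
by rewrite (le_trans h5)// (le_trans h2).
Qed.

Let lower (z : R * R) : set RR := [set s | s.1 < z.1 /\ s.2 < z.2].

Lemma measurable_lower z : measurable (lower z : set RR).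
Proof.
rewrite (_ : lower z = `]-oo, z.1[%classic `*` `]-oo, z.2[%classic).
  by apply: measurableX; exact: measurable_itv.
by apply/seteqP; split => s; rewrite /lower/= !in_itv.
Qed.

Lemma primitive_le W z : mu2.-integrable K (EFin \o W) ->
  `|primitive W z| <= \int[mu2]_(s in K) `|W s|.
Proof.
move=> iW; have mK := @measurable_square R (7 / 5).
have mKz : measurable (K `&` lower z : set RR) by apply: measurableI => //; exact: measurable_lower.
have iWz : mu2.-integrable (K `&` lower z) (EFin \o W).
  by apply: integrableS iW => //; exact: subIsetl.
rewrite (le_trans (le_normr_Rintegral mKz iWz))//.
by apply: le_Rintegral_subset => //; exact: subIsetl.
Qed.

Let strip1 (x d : R) : set RR := K `&` [set s | x - d <= s.1 <= x + d].
Let strip2 (y d : R) : set RR := K `&` [set s | y - d <= s.2 <= y + d].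

Let mu_itv (a b : R) : a <= b -> mu `[a, b]%classic = (b - a)%:E.
Proof.
move=> ab; rewrite lebesgue_measure_itv/= lte_fin -EFinB; case: ltP => // ba.
by congr EFin; apply/eqP; rewrite eq_sym subr_eq0; apply/eqP/le_anti; rewrite ab ba.
Qed.

Let strip1P x d : 0 <= d -> measurable (strip1 x d) /\ (mu2 (strip1 x d) <= (28 / 5 * d)%:E)%E.
Proof.
move=> d0; have mC : measurable (`[x - d, x + d]%classic `*` `[- (7 / 5), 7 / 5]%classic : set RR).
  by apply: measurableX; exact: measurable_itv.
have mS : measurable (strip1 x d).
  rewrite (_ : strip1 x d = K `&` (`[x - d, x + d]%classic `*` setT)).
    by apply: measurableI; [exact: measurable_square|apply: measurableX => //; exact: measurable_itv].
  by apply/seteqP; split => s; rewrite /strip1/= !in_itv/=; tauto.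
split => //.
apply: (@le_trans _ _ (mu2 (`[x - d, x + d]%classic `*` `[- (7 / 5), 7 / 5]%classic))).
  apply: le_measure; rewrite ?inE// => s [[s1 s2] h].
  by split; rewrite /= in_itv/= -?ler_norml.
rewrite product_measure1E; [|exact: measurable_itv..].
rewrite -[leLHS]/(mu _ * mu _)%E !mu_itv; [|lra..].
by rewrite -EFinM lee_fin; lra.
Qed.

Let strip2P x d : 0 <= d -> measurable (strip2 x d) /\ (mu2 (strip2 x d) <= (28 / 5 * d)%:E)%E.
Proof.
move=> d0; have mC : measurable (`[- (7 / 5), 7 / 5]%classic `*` `[x - d, x + d]%classic : set RR).
  by apply: measurableX; exact: measurable_itv.
have mS : measurable (strip2 x d).
  rewrite (_ : strip2 x d = K `&` (setT `*` `[x - d, x + d]%classic)).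
    by apply: measurableI; [exact: measurable_square|apply: measurableX => //; exact: measurable_itv].
  by apply/seteqP; split => s; rewrite /strip2/= !in_itv/=; tauto.
split => //.
apply: (@le_trans _ _ (mu2 (`[- (7 / 5), 7 / 5]%classic `*` `[x - d, x + d]%classic))).
  apply: le_measure; rewrite ?inE// => s [[s1 s2] h].
  by split; rewrite /= in_itv/= -?ler_norml.
rewrite product_measure1E; [|exact: measurable_itv..].
rewrite -[leLHS]/(mu _ * mu _)%E !mu_itv; [|lra..].
by rewrite -EFinM lee_fin; lra.
Qed.

Let lt_far (x y s d : R) : `|x - y| <= d -> ~ (x - d <= s <= x + d) ->
  (s < x) = (s < y).
Proof.
rewrite ler_norml => /andP[h1 h2] /negP; rewrite negb_and -!ltNge => h.
by apply/idP/idP => h3; case/orP: h => h; lra.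
Qed.

(** The domains of integration for z and z' differ only within two strips along the coordinate lines
    through z; absolute continuity of the integral makes their contribution small. *)
Lemma primitive_unif_continuous W (e : R) : mu2.-integrable K (EFin \o W) -> 0 < e ->
  exists2 d, 0 < d & forall z z' : R * R, `|z.1 - z'.1| <= d -> `|z.2 - z'.2| <= d ->
    `|primitive W z - primitive W z'| <= e.
Proof.
move=> iW e0; have mK := @measurable_square R (7 / 5).
have iw : mu2.-integrable setT (EFin \o (W \_ K)).
  by rewrite -restrict_EFin; apply/(integrable_mkcond _ mK).
have e2 : 0 < e / 2 by rewrite divr_gt0.
have [d0 [d00 hd]] := integral_normr_continuous iw e2.
(* The two strips have total area at most 2 * 28/5 * d0/12 = 14/15 * d0, below [d0]. *)
exists (d0 / 12); first by rewrite divr_gt0.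
move=> z z' h1 h2; set d := d0 / 12 in h1 h2.
have dge0 : 0 <= d by rewrite divr_ge0// ltW.
have [m1 l1] := strip1P z.1 dge0; have [m2 l2] := strip2P z.2 dge0.
pose S := strip1 z.1 d `|` strip2 z.2 d.
have mS : measurable S by exact: measurableU.
have muS : (mu2 S < d0%:E)%E.
  apply: (le_lt_trans (measureU2 _ m1 m2)).
  apply: (le_lt_trans (leeD l1 l2)); rewrite -EFinD lte_fin /d; lra.
have hS := hd _ mS muS.
have mKz y : measurable (K `&` lower y : set RR) by apply: measurableI => //; exact: measurable_lower.
have E y : primitive W y = \int[mu2]_(s in K `&` lower y) (W \_ K) s.
  apply: eq_Rintegral => s; rewrite inE => -[sK _]; by rewrite patchE mem_set.
rewrite !E; apply: (le_trans (Rintegral_dist_le (mKz z) (mKz z') mS iw _)); last first.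
  by rewrite mulrC -ler_pdivlMr// ltW.
move=> s nS; rewrite /=.
suff : K s -> ((s.1 < z.1) = (s.1 < z'.1)) /\ ((s.2 < z.2) = (s.2 < z'.2)).
  by move=> h; split => -[sK [s1 s2]]; have [e1 e3] := h sK; split => //; split; rewrite ?e1 ?e3// -?e1 -?e3.
move=> sK; split; [apply: (lt_far h1)|apply: (lt_far h2)] => h; apply: nS.
  by left; split.
by right; split.
Qed.

End PrimitiveBounds.

(** * Sup bound and uniform continuity of Sobolev functions on the disc *)

Section SobolevOnDisc.
Context {R : realType}.
Notation RR := (measurableTypeR R * measurableTypeR R)%type.
Notation mu := (@lebesgue_measure R).
Notation mu2 := (mu \x mu)%E.
Notation K := (square (7 / 5 : R)).
Implicit Types (u v e W : R * R -> R) (f g : R -> R).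

(** The part of [sobolev] that concerns existence only. It passes to the difference of two maps by
    linearity, while size is measured by [sobolev_norm]. *)
Definition weakly_differentiable k Omega u : Prop :=
  forall a b, (a + b <= k)%N -> exists v, is_weak_derivative Omega a b u v.

Lemma sobolev_weakly_differentiable k (p : R) Omega u :
  sobolev k p Omega u -> weakly_differentiable k Omega u.
Proof. by move=> Su a b /Su[v huv _]; exists v. Qed.

Lemma weak_derivativeP k Omega u a b : (a + b <= k)%N -> weakly_differentiable k Omega u ->
  is_weak_derivative Omega a b u (weak_derivative Omega a b u).
Proof. by move=> abk /(_ _ _ abk) h; exact: (xgetPex (fun=> 0) h). Qed.

Lemma mu2_K : mu2 K = (196 / 25)%:E.
Proof.
rewrite squareE product_measure1E; [|exact: measurable_itv..].
rewrite -[LHS]/(mu _ * mu _)%E !lebesgue_measure_itv/= lte_fin.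
have -> : (- (7 / 5) < 7 / 5 :> R) by lra.
by rewrite -EFinB -EFinM; congr EFin; field.
Qed.

Lemma le_1DpowR (p t : R) : 1 <= p -> 0 <= t -> t <= 1 + t `^ p.
Proof.
move=> p1 t0; have [t1|t1] := leP t 1; first by rewrite (le_trans t1)// lerDl powR_ge0.
rewrite (@le_trans _ _ (t `^ p))// ?lerDr// -[leLHS]powRr1//.
by apply: ler_powR => //; exact: ltW.
Qed.

(** The inequality s <= 1 + s^p at s = t / eps; integrated over a set of finite measure, it bounds
    an L^1-norm by an L^p-norm. *)
Lemma le_scaled_powR (p eps t : R) : 1 <= p -> 0 < eps -> 0 <= t ->
  t <= eps + eps / eps `^ p * t `^ p.
Proof.
move=> p1 e0 t0; have te0 : 0 <= t / eps by rewrite divr_ge0// ltW.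
have ep : 0 < eps `^ p by rewrite powR_gt0.
have E : (t / eps) `^ p = t `^ p / eps `^ p.
  by apply: (mulIf (lt0r_neq0 ep)); rewrite divfK ?gt_eqF// -powRM ?(ltW e0)// divfK ?gt_eqF.
have := le_1DpowR p1 te0; rewrite ler_pdivrMr// E => /le_trans; apply.
rewrite le_eqVlt; apply/orP; left; apply/eqP; field; exact: lt0r_neq0.
Qed.

(** In [le_scaled_powR] the first term integrates to 196/25 * eps, by the area of the square, and
    the second to at most eps; 196/25 + 1 is below 9. *)
Lemma Rintegral_norm_lt (p eps : R) e : 1 <= p -> 0 < eps ->
    mu2.-integrable K (EFin \o e) ->
    ('N[@lebesgue2 R]_(p%:E)[EFin \o (e \_ disc)] < eps%:E)%E ->
  \int[mu2]_(z in K) `|e z| <= 9 * eps.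
Proof.
move=> p1 e0 ie hN.
have p0 : p != 0 by rewrite gt_eqF// (lt_le_trans ltr01).
have p0' : 0 < p by rewrite (lt_le_trans ltr01).
have mK := @measurable_square R (7 / 5).
have me : measurable_fun K e by apply/measurable_EFinP; exact: measurable_int ie.
have h1 : (\int[mu2]_z (`|(e \_ disc) z| `^ p)%:E <= (eps `^ p)%:E)%E.
  have -> : (\int[mu2]_z (`|(e \_ disc) z| `^ p)%:E =
     'N[mu2]_(p%:E)[EFin \o (e \_ disc)] `^ p)%E by rewrite poweR_Lnorm.
  rewrite -poweR_EFin; apply: gt0_ler_poweR; rewrite ?ltW//.
  - by rewrite in_itv/= Lnorm_ge0 leey.
  - by rewrite in_itv/= lee_fin (ltW e0) leey.
have h2 : (\int[mu2]_(z in K) (`|e z| `^ p)%:E <= (eps `^ p)%:E)%E.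
  apply: le_trans h1; rewrite integral_mkcond; apply: ge0_le_integralT => z.
    by rewrite patchE; case: ifP => // _; rewrite lee_fin powR_ge0.
  rewrite patchE; case: ifPn => [|_]; last by rewrite lee_fin powR_ge0.
  by rewrite inE => /square_disc zd; rewrite patchE mem_set.
have mep : measurable_fun K (fun z => `|e z| `^ p).
  apply: (measurableT_comp (measurable_powR _)).
  exact: measurableT_comp.
have epsp : 0 < eps `^ p by rewrite powR_gt0.
have h3 : (\int[mu2]_(z in K) (`|e z|)%:E <= (9 * eps)%:E)%E.
  apply: (@le_trans _ _ (\int[mu2]_(z in K) (eps%:E + (eps / eps `^ p)%:E * (`|e z| `^ p)%:E))%E).
    apply: ge0_le_integral => //.
    - by apply/measurable_EFinP; exact: measurableT_comp.
    - apply/measurable_EFinP; apply: measurable_funD => //.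
      by apply: measurable_funM.
    move=> z _; rewrite -EFinM -EFinD lee_fin.
    exact: le_scaled_powR.
  rewrite ge0_integralD//; last 3 first.
  - by move=> z _; rewrite lee_fin ltW.
  - by move=> z _; rewrite -EFinM lee_fin mulr_ge0 ?powR_ge0// divr_ge0// ltW.
  - by apply/measurable_EFinP; apply: measurable_funM.
  rewrite integral_cst// ge0_integralZl//; last 2 first.
  - exact/measurable_EFinP.
  - by rewrite lee_fin divr_ge0// ltW.
  apply: (@le_trans _ _ ((eps * (196 / 25))%:E + (eps / eps `^ p)%:E * (eps `^ p)%:E)%E).
    apply: leeD; first by rewrite -[X in (_ * X)%E]/(mu2 K) mu2_K -EFinM.
    by apply: lee_wpmul2l => //; rewrite lee_fin divr_ge0// ltW.
  rewrite -EFinM -EFinD lee_fin divfK ?gt_eqF//; lra.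
rewrite -lee_fin (le_trans _ h3)// /Rintegral fineK//.
by apply: integrable_fin_num => //; exact: (integrable_norm ie).
Qed.

Lemma le_sobolev_norm k (p : R) Omega u a b : (a + b <= k)%N ->
  ('N[@lebesgue2 R]_(p%:E)[EFin \o (weak_derivative Omega a b u \_ Omega)] <=
   sobolev_norm k p Omega u)%E.
Proof.
move=> abk.
have ak : (a < k.+1)%N by rewrite ltnS (leq_trans _ abk)// leq_addr.
have bk : (b < k.+1)%N by rewrite ltnS (leq_trans _ abk)// leq_addl.
rewrite /sobolev_norm (bigD1 (Ordinal ak, Ordinal bk))//= leeDl//.
by apply: sume_ge0 => ab _; exact: Lnorm_ge0.
Qed.

Lemma cut_density_le (M : R) e00 e10 e01 e11 z :
    `|cutoff z.1| <= M -> `|cutoff' z.1| <= M ->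
    `|cutoff z.2| <= M -> `|cutoff' z.2| <= M ->
  `|cut_density e00 e10 e01 e11 z| <=
    M ^+ 2 * (`|e11 z| + `|e10 z| + `|e01 z| + `|e00 z|).
Proof.
move=> h1 h1' h2 h2'.
have h (e x y : R) : `|x| <= M -> `|y| <= M -> `|e * (x * y)| <= M ^+ 2 * `|e|.
  move=> hx hy; rewrite !normrM mulrC ler_wpM2r// expr2; exact: ler_pM.
rewrite /cut_density (le_trans (ler_normD _ _))// mulrDr lerD ?h//.
rewrite (le_trans (ler_normD _ _))// mulrDr lerD ?h//.
by rewrite (le_trans (ler_normD _ _))// mulrDr lerD ?h.
Qed.

Lemma weak_derivatives_disc k u : (2 <= k)%N -> weakly_differentiable k disc u ->
  [/\ is_weak_derivative disc 0 0 u (weak_derivative disc 0 0 u),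
      is_weak_derivative disc 1 0 u (weak_derivative disc 1 0 u),
      is_weak_derivative disc 0 1 u (weak_derivative disc 0 1 u) &
      is_weak_derivative disc 1 1 u (weak_derivative disc 1 1 u)].
Proof.
move=> k2 Su; split; apply: (weak_derivativeP _ Su) => //.
- by rewrite (leq_trans _ k2).
- by rewrite (leq_trans _ k2).
Qed.

Lemma is_weak_derivative_integrable u e a b : is_weak_derivative disc a b u e ->
  mu2.-integrable K (EFin \o e).
Proof. by move=> [_ le _]; apply: le; [exact: compact_square|exact: square_disc]. Qed.

Lemma tensor_cutoff_ge (z : R * R) : square (5 / 4) z ->
  (flat 0 (3 / 20 : R)) ^+ 4 <= tensor cutoff cutoff z.
Proof.
move=> [z1 z2]; rewrite (_ : 4 = 2 + 2)%N// exprD.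
by apply: ler_pM; rewrite ?sqr_ge0//; exact: cutoff_ge.
Qed.

Lemma square_mono (r s : R) : r <= s -> square r `<=` square s.
Proof. by move=> rs z [z1 z2]; split; exact: le_trans rs. Qed.

(** The constant depends on the cut-off alone: 36 is four weak derivatives times the 9 of
    [Rintegral_norm_lt], [M ^+ 2] bounds the products of cut-off factors, and [c0] bounds the
    product cut-off from below where it is divided out. *)
Lemma sobolev_ae_le : exists2 C : R, 0 < C &
  forall k (p eps : R) u, (2 <= k)%N -> 1 <= p -> 0 < eps -> weakly_differentiable k disc u ->
    (sobolev_norm k p disc u < eps%:E)%E ->
    {ae mu2, forall z, square (5 / 4) z -> `|u z| <= C * eps}.
Proof.
have [M1 M10 hM1] := continuous_bounded_itv (7 / 5) (smooth1_continuous (@smooth1_cutoff R)).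
have [M2 M20 hM2] := continuous_bounded_itv (7 / 5) (smooth1_continuous (@smooth1_cutoff' R)).
pose M := M1 + M2 + 1; pose c0 := (flat 0 (3 / 20 : R)) ^+ 4.
have c00 : 0 < c0 by rewrite exprn_gt0// flat_gt0// divr_gt0.
have M0 : 0 < M by rewrite /M; lra.
exists (M ^+ 2 * 36 / c0); first by rewrite divr_gt0// mulr_gt0// exprn_gt0.
move=> k p eps u k2 p1 e0 Su hN.
have [w00 w10 w01 w11] := weak_derivatives_disc k2 Su.
have i00 := is_weak_derivative_integrable w00.
have i10 := is_weak_derivative_integrable w10.
have i01 := is_weak_derivative_integrable w01.
have i11 := is_weak_derivative_integrable w11.
have hI a b : (a + b <= 2)%N ->
    mu2.-integrable K (EFin \o weak_derivative disc a b u) ->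
    \int[mu2]_(z in K) `|weak_derivative disc a b u z| <= 9 * eps.
  move=> ab ie; apply: (Rintegral_norm_lt p1 e0 ie).
  exact: le_lt_trans (le_sobolev_norm _ _ _ (leq_trans ab k2)) hN.
have mK := @measurable_square R (7 / 5).
have iW := integrable_cut_density i00 i10 i01 i11.
set W := cut_density _ _ _ _ in iW.
have hW : \int[mu2]_(z in K) `|W z| <= M ^+ 2 * (36 * eps).
  have n e : mu2.-integrable K (EFin \o e) -> mu2.-integrable K (EFin \o (fun z => `|e z|)).
    by move=> ie; exact: (integrable_norm ie).
  have is4 := integrableD mK (integrableD mK (integrableD mK (n _ i11) (n _ i10)) (n _ i01)) (n _ i00).
  apply: (@le_trans _ _ (\int[mu2]_(z in K) (M ^+ 2 * (`|weak_derivative disc 1 1 u z| +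
     `|weak_derivative disc 1 0 u z| + `|weak_derivative disc 0 1 u z| + `|weak_derivative disc 0 0 u z|)))).
    apply: le_Rintegral => //.
    - exact: n.
    - exact: (integrableZl mK (M ^+ 2) is4).
    - move=> z [z1 z2]; apply: cut_density_le; rewrite /M.
      + by rewrite (le_trans (hM1 _ z1))//; lra.
      + by rewrite (le_trans (hM2 _ z1))//; lra.
      + by rewrite (le_trans (hM1 _ z2))//; lra.
      + by rewrite (le_trans (hM2 _ z2))//; lra.
  rewrite RintegralZl// ler_wpM2l ?sqr_ge0//.
  rewrite Rintegral_sum4//; try exact: n.
  have -> : 36 * eps = 9 * eps + 9 * eps + 9 * eps + 9 * eps by ring.
  apply: lerD; last exact: (hI 0%N 0%N isT i00).
  apply: lerD; last exact: (hI 0%N 1%N isT i01).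
  by apply: lerD; [exact: (hI 1%N 1%N isT i11)|exact: (hI 1%N 0%N isT i10)].
apply: ae_weaken (ae_eq_primitive w00 w10 w01 w11) => z hz zQ.
have zK : K z by apply: square_mono zQ; lra.
have := le_trans (primitive_le z iW) hW; rewrite /W -(hz zK) normrM => h.
rewrite -mulrA [c0^-1 * _]mulrC mulrA ler_pdivlMr// -mulrA.
apply: le_trans h; rewrite ler_wpM2l//.
by rewrite (le_trans (tensor_cutoff_ge zQ))// ler_norm.
Qed.

(** Off a null set u is a uniformly continuous primitive divided by the product cut-off, which on
    the smaller square is Lipschitz and at least [c0]. *)
Lemma ae_unif_continuous k (delta : R) u : (2 <= k)%N ->
  weakly_differentiable k disc u -> 0 < delta ->
  exists2 rho : R, 0 < rho & exists2 D : set (R * R), {ae mu2, forall z, D z} &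
    forall z z', D z -> D z' -> square (5 / 4) z -> square (5 / 4) z' ->
      `|z.1 - z'.1| <= rho -> `|z.2 - z'.2| <= rho -> `|u z - u z'| <= delta.
Proof.
move=> k2 Su d0.
have [w00 w10 w01 w11] := weak_derivatives_disc k2 Su.
have iW := integrable_cut_density (is_weak_derivative_integrable w00)
  (is_weak_derivative_integrable w10) (is_weak_derivative_integrable w01)
  (is_weak_derivative_integrable w11).
set W := cut_density _ _ _ _ in iW.
pose c0 := (flat 0 (3 / 20 : R)) ^+ 4.
have c00 : 0 < c0 by rewrite exprn_gt0// flat_gt0// divr_gt0.
pose B := (\int[mu2]_(z in K) `|W z|) / c0.
have B0 : 0 <= B by apply: divr_ge0; [exact: Rintegral_ge0|exact: ltW].
have [L L0 hL] := smooth1_lipschitz (5 / 4) (@smooth1_cutoff R).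
have [M M0 hM] := continuous_bounded_itv (5 / 4) (smooth1_continuous (@smooth1_cutoff R)).
(* [B] bounds |u| and [2 * M * L] bounds the increments of the product cut-off; the added 1 keeps
   the divisor positive. *)
pose A := B * (2 * M * L) + 1.
have A0 : 0 < A by rewrite /A ltr_wpDl// mulr_ge0// mulr_ge0// mulr_ge0.
have cd : 0 < c0 * delta / 2 by rewrite divr_gt0// mulr_gt0.
have [r r0 hr] := primitive_unif_continuous iW cd.
exists (Num.min r (c0 * delta / 2 / A)); first by rewrite lt_min r0 divr_gt0.
exists [set z | K z -> u z * tensor cutoff cutoff z = primitive W z].
  exact: ae_eq_primitive.
move=> z z' /= Dz Dz' zQ zQ'; rewrite !le_min => /andP[h1 h1'] /andP[h2 h2'].
have zK : K z by apply: square_mono zQ; lra.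
have zK' : K z' by apply: square_mono zQ'; lra.
move: (hr z z' h1 h2); rewrite -(Dz zK) -(Dz' zK') => hP.
have cz := tensor_cutoff_ge zQ; have cz' := tensor_cutoff_ge zQ'.
have uB : `|u z'| <= B.
  rewrite /B ler_pdivlMr//; apply: le_trans (primitive_le z' iW).
  by rewrite -(Dz' zK') normrM ler_wpM2l// (le_trans cz')// ler_norm.
have hchi : `|tensor cutoff cutoff z - tensor cutoff cutoff z'| <= 2 * M * L * (c0 * delta / 2 / A).
  case: zQ zQ' => q1 q2 [q1' q2'].
  have -> : tensor cutoff cutoff z - tensor cutoff cutoff z' =
      (cutoff z.1 - cutoff z'.1) * cutoff z.2 + cutoff z'.1 * (cutoff z.2 - cutoff z'.2).
    by rewrite /tensor; ring.
  set t := c0 * delta / 2 / A in h1' h2' *.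
  have -> : 2 * M * L * t = M * (L * t) + M * (L * t) by ring.
  rewrite (le_trans (ler_normD _ _))// (normrM _ (cutoff z.2)) (normrM (cutoff z'.1)).
  apply: lerD.
    rewrite mulrC; apply: ler_pM => //; first exact: hM.
    by rewrite (le_trans (hL _ _ q1 q1'))// ler_wpM2l.
  apply: ler_pM => //; first exact: hM.
  by rewrite (le_trans (hL _ _ q2 q2'))// ler_wpM2l.
have key : c0 * `|u z - u z'| <= c0 * delta.
  apply: (@le_trans _ _ (`|(u z - u z') * tensor cutoff cutoff z|)).
    by rewrite normrM mulrC ler_wpM2l// (le_trans cz)// ler_norm.
  (* The increment of the cut-off u and the increment of the cut-off are separated; each is allowed
     [c0 * delta / 2]. *)
  have -> : (u z - u z') * tensor cutoff cutoff z =
     (u z * tensor cutoff cutoff z - u z' * tensor cutoff cutoff z') -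
      u z' * (tensor cutoff cutoff z - tensor cutoff cutoff z') by ring.
  rewrite (le_trans (ler_normB _ _))// (_ : c0 * delta = c0 * delta / 2 + c0 * delta / 2); last by field.
  rewrite lerD// normrM.
  apply: (@le_trans _ _ (B * (2 * M * L * (c0 * delta / 2 / A)))); first by apply: ler_pM.
  have -> : B * (2 * M * L * (c0 * delta / 2 / A)) = c0 * delta / 2 * (B * (2 * M * L) / A).
    by rewrite (mulrA B) mulrCA.
  apply: ler_piMr; first exact: ltW.
  by rewrite ler_pdivrMr// mul1r /A lerDl ler01.
by rewrite ler_pM2l in key.
Qed.

End SobolevOnDisc.

(** * Null sets of the plane under fibrewise affine maps *)

Section NullSets.
Context {R : realType}.
Notation R1 := (measurableTypeR R).
Notation RR := (measurableTypeR R * measurableTypeR R)%type.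
Notation mu := (@lebesgue_measure R).
Notation mu2 := (mu \x mu)%E.

Let affine (a b : R) : R1 -> R1 := fun y => a * y + b.

Let measurable_affine a b : measurable_fun setT (affine a b).
Proof.
by apply: measurable_funD => //; apply: measurable_funM.
Qed.

(** The rescaled pushforward agrees with Lebesgue measure on half-open intervals, which determine
    it. *)
Lemma lebesgue_measure_affine (a b : R) (E : set R1) : a != 0 -> measurable E ->
  mu E = (`|a|%:E * mu (affine a b @^-1` E))%E.
Proof.
move=> a0 mE.
pose nu := measure_function_pushforward__canonical__measure_function_Measure mu (measurable_affine a b).
apply: (@lebesgue_measure_unique R (mscale (NngNum (normr_ge0 a)) nu)) => // X [[x y] _ <-] /=.
rewrite /mscale/= /pushforward.
have [xy|yx] := ltP x y; last first.
  rewrite set_itv_ge ?bnd_simp -?leNgt// preimage_set0 !measure0 mule0//.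
rewrite lebesgue_measure_itv/= lte_fin xy.
have [apos|aneg] := ltP 0 a.
  have -> : affine a b @^-1` `]x, y] = `](x - b) / a, (y - b) / a]%classic.
    apply/seteqP; split => z; rewrite /affine/= !in_itv/= ltr_pdivrMr// ler_pdivlMr// (mulrC z) ltrBlDr lerBrDr//.
  rewrite lebesgue_measure_itv/= lte_fin ltr_pM2r ?invr_gt0// ltrD2r xy.
  by rewrite -!EFinB -EFinM; congr EFin; rewrite gtr0_norm//; field.
have {}aneg : a < 0 by rewrite lt_neqAle a0.
have -> : affine a b @^-1` `]x, y] = `[(y - b) / a, (x - b) / a[%classic.
  apply/seteqP; split => z; rewrite /affine/= !in_itv/= ler_ndivrMr// ltr_ndivlMr// (mulrC z) ltrBlDr lerBrDr andbC//.
rewrite lebesgue_measure_itv/= lte_fin ltr_nM2r ?invr_lt0// ltrD2r xy.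
by rewrite -!EFinB -EFinM; congr EFin; rewrite ltr0_norm//; field.
Qed.

Definition null_preserving (phi : RR -> RR) : Prop :=
  measurable_fun setT phi /\
  forall N : set RR, measurable N -> mu2 N = 0 -> mu2 (phi @^-1` N) = 0.

Let mu_xsection_ae (N : set RR) : measurable N ->
  mu2 N = 0 <-> {ae mu, forall x, mu (xsection N x) = 0}.
Proof.
move=> mN; have ms := @measurable_fun_xsection _ _ R1 R1 R mu N mN.
have := ae_eq_integral_abs mu measurableT ms.
have -> : (\int[mu]_x `|(mu \o xsection N) x| = mu2 N)%E.
  by apply: eq_integral => x _; rewrite gee0_abs.
move=> h; split.
  by move=> /h; apply: filterS => x /(_ I).
by move=> hae; apply/h; apply: filterS hae => x /= -> _.
Qed.

(** By Fubini a set is null when almost all its vertical sections are, and on almost every section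
    the map is affine with nonzero slope. *)
Lemma null_preserving_fiber (al be : R1 -> R1) :
  measurable_fun setT al -> measurable_fun setT be ->
  {ae mu, forall x, al x != 0} ->
  null_preserving (fun z => (z.1, al z.1 * z.2 + be z.1)).
Proof.
move=> mal mbe al0.
have mphi : measurable_fun setT (fun z : RR => (z.1, al z.1 * z.2 + be z.1)).
  apply: measurable_fun_pair; first exact: measurable_fst.
  apply: measurable_funD; last exact: (measurableT_comp mbe measurable_fst).
  apply: measurable_funM; last exact: measurable_snd.
  exact: (measurableT_comp mal measurable_fst).
split=> // N mN N0.
have mP : measurable ((fun z : RR => (z.1, al z.1 * z.2 + be z.1)) @^-1` N).
  by rewrite -[X in measurable X]setTI; exact: mphi.
apply/mu_xsection_ae => //; move/mu_xsection_ae : N0 => /(_ mN) N0.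
near=> x.
have ax : al x != 0 by near: x.
have Nx : mu (xsection N x) = 0 by near: x.
have := lebesgue_measure_affine (be x) ax (measurable_xsection x mN).
rewrite Nx => /esym/eqP; rewrite mule_eq0 eqe normr_eq0 (negbTE ax)/= => /eqP.
congr (mu _ = _); apply/seteqP; split => y; by rewrite /xsection/affine/= ?inE/= ?inE.
Unshelve. all: by end_near.
Qed.

Lemma null_preserving_swap : null_preserving (fun z => (z.2, z.1)).
Proof.
have msw : measurable_fun setT (fun z : RR => (z.2, z.1)).
  by apply: measurable_fun_pair; [exact: measurable_snd|exact: measurable_fst].
split=> // N mN N0.
have := @indic_fubini_tonelli _ _ R1 R1 R mu mu _ mN.
rewrite (indic_fubini_tonelli_FE mu mN) (indic_fubini_tonelli_GE mu mN) => h.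
rewrite -N0; transitivity (\int[mu]_x (mu \o ysection N) x)%E; last exact: esym.
apply: eq_integral => x _ /=.
by congr (mu _); apply/seteqP; split => y; rewrite /xsection/ysection/= ?inE/= ?inE.
Qed.

End NullSets.

(** * Complex inversion and complex affine maps preserve null sets *)

Section AePreserving.
Context {R : realType}.
Notation R1 := (measurableTypeR R).
Notation RR := (measurableTypeR R * measurableTypeR R)%type.
Notation mu := (@lebesgue_measure R).
Notation mu2 := (mu \x mu)%E.
Implicit Types (phi psi : R * R -> R * R).

Definition ae_preserving phi : Prop := forall P : R * R -> Prop,
  {ae mu2, forall z, P z} -> {ae mu2, forall z, P (phi z)}.

Lemma null_preserving_ae phi : null_preserving phi -> ae_preserving phi.
Proof.
move=> [mphi hphi] P [N [mN N0 PN]]; exists (phi @^-1` N); split.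
- by rewrite -[X in measurable X]setTI; exact: mphi.
- exact: hphi.
- by move=> z /= Pz; apply: PN.
Qed.

Lemma ae_preserving_comp phi psi :
  ae_preserving phi -> ae_preserving psi -> ae_preserving (phi \o psi).
Proof. by move=> hphi hpsi P /hphi /hpsi. Qed.

Lemma ae_preserving_eq phi psi : ae_preserving phi ->
  {ae mu2, forall z, phi z = psi z} -> ae_preserving psi.
Proof.
move=> hphi e P /hphi /(ae_and e).
by apply: ae_weaken => z [->].
Qed.

Lemma ae_fst_neq (a : R) : {ae mu2, forall z, z.1 != a}.
Proof.
exists ([set a] `*` setT); split.
- by apply: measurableX => //; exact: measurable_set1.
- by rewrite product_measure1E// -[LHS]/(mu _ * mu _)%E lebesgue_measure_set1 mul0e.
- by move=> z /= /negP; rewrite negbK => /eqP.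
Qed.

Lemma ae_preserving_fiber (al be : R -> R) :
  measurable_fun [set: R1] (al : R1 -> R1) -> measurable_fun [set: R1] (be : R1 -> R1) ->
  (forall x, x != 0 -> al x != 0) ->
  ae_preserving (fun z => (z.1, al z.1 * z.2 + be z.1)).
Proof.
move=> mal mbe al0; apply: null_preserving_ae; apply: null_preserving_fiber => //.
exists [set 0]; split; [exact: measurable_set1|exact: lebesgue_measure_set1|].
by move=> x /= h; apply/eqP; apply: contra_notT h => /al0.
Qed.

Lemma ae_preserving_swap : ae_preserving (fun z => (z.2, z.1)).
Proof. exact/null_preserving_ae/null_preserving_swap. Qed.

Lemma ae_snd_neq (a : R) : {ae mu2, forall z, z.2 != a}.
Proof. exact: (ae_preserving_swap (ae_fst_neq a)). Qed.

Lemma measurable_inv_real : measurable_fun [set: R1] (fun x : R1 => x^-1 : R1).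
Proof.
have mD : measurable [set x : R1 | x != 0].
  rewrite (_ : [set x | _] = ~` [set 0]); first by apply: measurableC; exact: measurable_set1.
  by apply/seteqP; split => x /= /eqP.
rewrite -(setUv [set x : R1 | x != 0]); apply/measurable_funU => //.
  exact: measurableC.
split.
  apply: open_continuous_measurable_fun.
    by apply: open_neq.
  by move=> x; rewrite inE/= => x0; exact: inv_continuous.
rewrite (_ : ~` _ = [set 0]); first exact: measurable_fun_set1.
by apply/seteqP; split => x /=; [move=> /negP; rewrite negbK => /eqP|move=> ->; rewrite eqxx].
Qed.

Definition plane_inv (z : R * R) : R * R :=
  (z.1 / (z.1 ^+ 2 + z.2 ^+ 2), - (z.2 / (z.1 ^+ 2 + z.2 ^+ 2))).

Definition plane_affine (a b c d : R) (z : R * R) : R * R :=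
  (a * z.1 - b * z.2 + c, b * z.1 + a * z.2 + d).

Let mid : measurable_fun [set: R1] (id : R1 -> R1). Proof. exact: measurable_id. Qed.
Let mcst (c : R) : measurable_fun [set: R1] (cst c : R1 -> R1). Proof. exact: measurable_cst. Qed.

(* (x, y) |-> (x, xy) |-> (x/(xy), xy) |-> (1/y, xy/y): inversion of a coordinate
   is a composition of fibrewise linear maps. *)
Lemma ae_preserving_inv_coord : ae_preserving (fun z => (z.2^-1, z.1)).
Proof.
have f1 := ae_preserving_fiber mid (mcst 0) (fun x h => h).
have f2 := ae_preserving_fiber measurable_inv_real (mcst 0) (fun x h => invr_neq0 h).
apply: (ae_preserving_eq (ae_preserving_comp f1 (ae_preserving_comp ae_preserving_swap
   (ae_preserving_comp f2 (ae_preserving_comp ae_preserving_swap f1))))).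
apply: ae_weaken (ae_and (ae_fst_neq 0) (ae_snd_neq 0)) => -[x y] /= [x0 y0].
by congr pair; field; rewrite ?x0 ?y0.
Qed.

(** In terms of the slope t = y/x, the first coordinate is (1/x) / (1 + t^2) and the second is -t
    times the first, so inversion is a chain of swaps, fibrewise linear maps and
    [ae_preserving_inv_coord]. *)
Lemma ae_preserving_plane_inv : ae_preserving plane_inv.
Proof.
have f1 := ae_preserving_fiber mid (mcst 0) (fun x h => h).
have f2 := ae_preserving_fiber measurable_inv_real (mcst 0) (fun x h => invr_neq0 h).
have m3 : measurable_fun [set: R1] (fun t : R1 => (1 + t ^+ 2)^-1 : R1).
  apply: (measurableT_comp measurable_inv_real).
  by apply: measurable_funD => //; exact: measurable_funX.
have f3 : ae_preserving (fun z => (z.1, (1 + z.1 ^+ 2)^-1 * z.2 + 0)).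
  apply: (ae_preserving_fiber m3 (mcst 0)) => t _.
  by rewrite invr_neq0// gt_eqF// ltr_pwDl// sqr_ge0.
have f4 : ae_preserving (fun z => (z.1, -1 * z.2 + 0)).
  by apply: (ae_preserving_fiber (mcst (-1)) (mcst 0)) => t _; rewrite oppr_eq0 oner_eq0.
have sw := ae_preserving_swap.
apply: (ae_preserving_eq (ae_preserving_comp f4 (ae_preserving_comp f1
  (ae_preserving_comp sw (ae_preserving_comp f3 (ae_preserving_comp sw
  (ae_preserving_comp ae_preserving_inv_coord (ae_preserving_comp sw f2)))))))).
apply: ae_weaken (ae_fst_neq 0) => -[x y] /= x0.
have h : x ^+ 2 + y ^+ 2 != 0.
  by rewrite gt_eqF// ltr_pwDl ?sqr_ge0// lt0r sqrf_eq0 x0 sqr_ge0.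
rewrite /plane_inv/=; congr pair; field; rewrite ?x0 ?h//=.
Qed.

(** For a != 0 the linear part factors into two fibrewise maps, one per coordinate, with slopes a
    and (a^2 + b^2)/a. For a = 0 a quarter turn, written as a reflection and a swap, makes b the
    leading coefficient. *)
Lemma ae_preserving_plane_affine (a b c d : R) : (a != 0) || (b != 0) ->
  ae_preserving (plane_affine a b c d).
Proof.
have sw := ae_preserving_swap.
have step a' b' c' d' : a' != 0 -> ae_preserving (plane_affine a' b' c' d').
  move=> a0.
  have s0 : a' ^+ 2 + b' ^+ 2 != 0.
    by rewrite gt_eqF// ltr_pwDl ?sqr_ge0// lt0r sqrf_eq0 a0 sqr_ge0.
  have f1 : ae_preserving (fun z => (z.1, a' * z.2 + (- b' * z.1 + c'))).
    apply: (ae_preserving_fiber (mcst a') (be := fun y => - b' * y + c')) => //.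
    by apply: measurable_funD => //; exact: measurable_funM.
  have f2 : ae_preserving (fun z => (z.1, (a' ^+ 2 + b' ^+ 2) / a' * z.2 + (b' / a' * z.1 + (d' - b' * c' / a')))).
    apply: (ae_preserving_fiber (mcst _) (be := fun y => b' / a' * y + (d' - b' * c' / a'))).
      by apply: measurable_funD => //; exact: measurable_funM.
    by move=> x _; rewrite /cst mulf_neq0 ?invr_neq0.
  apply: (ae_preserving_eq (ae_preserving_comp f2 (ae_preserving_comp sw (ae_preserving_comp f1 sw)))).
  by apply: aeW => -[x y] /=; rewrite /plane_affine/=; congr pair; field.
have [->|a0 _] := eqVneq a 0; last exact: step.
move=> /= b0.
have f4 : ae_preserving (fun z => (z.1, -1 * z.2 + 0)).
  by apply: (ae_preserving_fiber (mcst (-1)) (mcst 0)) => t _; rewrite oppr_eq0 oner_eq0.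
apply: (ae_preserving_eq (ae_preserving_comp sw (ae_preserving_comp f4 (step b 0 d (- c) b0)))).
by apply: aeW => -[x y] /=; rewrite /plane_affine/=; congr pair; ring.
Qed.

End AePreserving.

(** * Null sets of the sphere under Moebius maps *)

Section SphereNullSets.
Context {R : realType}.
Notation mu := (@lebesgue_measure R).
Notation mu2 := (mu \x mu)%E.
Notation C := (Cplx R).
Implicit Types (P Q : sphere R -> Prop) (z : R * R).

Lemma toC_eq0 z : (toC z == 0) = (z == (0, 0)).
Proof. by case: z => x y; rewrite /toC eq_complex /= xpair_eqE. Qed.

Lemma toC_plane_inv z : toC (plane_inv z) = (toC z)^-1.
Proof. by []. Qed.

Lemma toC_plane_affine (a b c d : R) z :
  toC (plane_affine a b c d z) = toC (a, b) * toC z + toC (c, d).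
Proof.
case: z => x y; rewrite /plane_affine /toC /=; apply/eqP; rewrite eq_complex /=.
by apply/andP; split; apply/eqP; ring.
Qed.

Lemma toC_surj (w : C) : exists z, w = toC z.
Proof. by case: w => x y; exists (x, y). Qed.

Lemma ae_neq z0 : {ae mu2, forall z, z != z0}.
Proof.
apply: ae_weaken (ae_fst_neq z0.1) => z; apply: contra_neq => ->//.
Qed.

Lemma ae_toC_affine (a b : C) (P : C -> Prop) : a != 0 ->
  {ae mu2, forall z, P (toC z)} -> {ae mu2, forall z, P (a * toC z + b)}.
Proof.
have [[a1 a2] ->] := toC_surj a; have [[b1 b2] ->] := toC_surj b.
rewrite toC_eq0 xpair_eqE negb_and => a0 hP.
have := ae_preserving_plane_affine b1 b2 a0 hP.
by apply: ae_weaken => z; rewrite toC_plane_affine.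
Qed.

Lemma ae_toC_inv (P : C -> Prop) :
  {ae mu2, forall z, P (toC z)} -> {ae mu2, forall z, P (toC z)^-1}.
Proof. by move=> hP; exact: (ae_preserving_plane_inv hP). Qed.

(** The second chart is the first one after inversion, which preserves null sets; its origin is a
    single point. *)
Lemma ae_sphereP P : ae_sphere P <-> {ae mu2, forall z, P (Some (toC z))}.
Proof.
split=> [/(_ true)//|hP [//|]].
have h := ae_and (ae_neq (0, 0)) (ae_toC_inv (P := fun w => P (Some w)) hP).
apply: ae_weaken h => z [z0 Pz].
by rewrite /sphere_chart toC_eq0 (negbTE z0).
Qed.

Lemma ae_sphere_weaken P Q : (forall x, P x -> Q x) -> ae_sphere P -> ae_sphere Q.
Proof. by move=> PQ hP b; apply: ae_weaken (hP b) => z; exact: PQ. Qed.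

Lemma ae_sphere_and P Q : ae_sphere P -> ae_sphere Q ->
  ae_sphere (fun x => P x /\ Q x).
Proof. by move=> hP hQ b; exact: (ae_and (hP b) (hQ b)). Qed.

Lemma ae_sphere_bigcap (P_ : nat -> sphere R -> Prop) :
  (forall n, ae_sphere (P_ n)) -> ae_sphere (fun x => forall n, P_ n x).
Proof.
move=> hP b; apply: ae_foralln => n; exact: hP.
Qed.

Lemma ae_sphere_neq (x0 : sphere R) : ae_sphere (fun x => x <> x0).
Proof.
apply/ae_sphereP; case: x0 => [w|]; last exact: aeW.
have [z0 ->] := toC_surj w; apply: ae_weaken (ae_neq z0) => z /eqP zz0 [] h1 h2.
by apply: zz0; case: z z0 h1 h2 {w} => x y [x' y'] /= -> ->.
Qed.

Lemma ae_sphere_ex P : ae_sphere P -> exists x, P x.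
Proof.
move=> /ae_sphereP [N [mN N0 PN]]; apply: contrapT => nP.
have : mu2 (square 1) = 0%E.
  apply: (subset_measure0 _ _ _ N0) => //; first exact: measurable_square.
  by move=> z _; apply: PN => /= Pz; apply: nP; exists (Some (toC z)).
rewrite squareE product_measure1E; [|exact: measurable_itv..].
rewrite -[LHS]/(mu _ * mu _)%E !lebesgue_measure_itv/= lte_fin.
have -> : (-1 < 1 :> R) by lra.
by rewrite -EFinB -EFinM => -[]; lra.
Qed.

Lemma det2E (F : comNzRingType) (A : 'M[F]_2) :
  \det A = A 0 0 * A 1 1 - A 0 1 * A 1 0.
Proof.
rewrite (expand_det_row _ 0) !big_ord_recl big_ord0 addr0 /cofactor !det_mx11 !mxE/=.
rewrite /bump /= !addn0 expr0 mul1r expr1 mulN1r mulrN; congr (_ * A _ _ - A _ _ * A _ _);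
  exact/val_inj.
Qed.

(** With determinant 1 and c != 0, the map is w -> a/c - 1/(c (c w + d)): affine, then inversion,
    then affine. For c = 0 it is affine. *)
Lemma ae_sphere_moebius_mx (A : 'M[C]_2) P : \det A = 1 -> ae_sphere P ->
  ae_sphere (P \o moebius_mx A).
Proof.
rewrite det2E => detA /ae_sphereP hP; apply/ae_sphereP.
set a := A 0 0 in detA *; set b := A 0 1 in detA *.
set c := A 1 0 in detA *; set d := A 1 1 in detA *.
have E w : moebius_mx A (Some w) =
    if c * w + d == 0 then None else Some ((a * w + b) / (c * w + d)).
  by rewrite /moebius_mx /= !mulr1.
have [c0|c0] := eqVneq c 0.
  have ad : a * d = 1 by rewrite -detA c0 mulr0 subr0.
  have d0 : d != 0 by apply: contra_eq_neq ad => ->; rewrite mulr0 eq_sym oner_eq0.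
  have a0 : a != 0 by apply: contra_eq_neq ad => ->; rewrite mul0r eq_sym oner_eq0.
  have := ae_toC_affine (P := fun w => P (Some w)) (b / d) (mulf_neq0 a0 (invr_neq0 d0)) hP.
  apply: ae_weaken => z /=; rewrite E c0 mul0r add0r (negbTE d0).
  by congr (P (Some _)); field.
have h1 : {ae mu2, forall z, P (Some (a / c - c^-1 * toC z))}.
  have := ae_toC_affine (P := fun w => P (Some w)) (a / c) (_ : - c^-1 != 0) hP.
  rewrite oppr_eq0 invr_eq0 => /(_ c0).
  by apply: ae_weaken => z; rewrite addrC mulNr.
have h2 : {ae mu2, forall z, toC z != 0 /\ P (Some (a / c - c^-1 * (toC z)^-1))}.
  apply: ae_and (ae_toC_inv (P := fun w => P (Some (a / c - c^-1 * w))) h1).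
  by apply: ae_weaken (ae_neq (0, 0)) => z; rewrite toC_eq0.
have := ae_toC_affine (P := fun w => w != 0 /\ P (Some (a / c - c^-1 * w^-1))) d c0 h2.
apply: ae_weaken => z /= [w0 Pz]; rewrite E (negbTE w0).
move: Pz; congr (P (Some _)).
have -> : b = (a * d - 1) / c by rewrite -detA; field.
by field; rewrite c0 w0.
Qed.

End SphereNullSets.

(** * The real-valued complex modulus *)

Section Modulus.
Context {R : realType}.
Notation C := (Cplx R).
Implicit Types (u v w : C).

(** The norm on [Cplx R] takes its values in [R[i]]; this version can be compared with real
    bounds. *)
Definition modulus (w : C) : R := Normc.normc w.

Lemma normCE w : `|w| = (modulus w)%:C%C. Proof. by []. Qed.

Lemma modulus_ge0 w : 0 <= modulus w.
Proof. by case: w => x y; exact: sqrtr_ge0. Qed.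

Lemma modulusM u v : modulus (u * v) = modulus u * modulus v.
Proof. exact: Normc.normcM. Qed.

Lemma modulusV u : modulus u^-1 = (modulus u)^-1.
Proof. exact: Normc.normcV. Qed.

Lemma modulus0 : modulus 0 = 0. Proof. exact: Normc.normc0. Qed.

Lemma modulus1 : modulus 1 = 1. Proof. exact: Normc.normc1. Qed.

Lemma modulus_eq0 u : (modulus u == 0) = (u == 0).
Proof. by apply/eqP/eqP => [/Normc.eq0_normc|->]; [|exact: modulus0]. Qed.

Lemma modulus_gt0 u : (0 < modulus u) = (u != 0).
Proof. by rewrite lt0r modulus_eq0 modulus_ge0 andbT. Qed.

Lemma modulusD u v : modulus (u + v) <= modulus u + modulus v.
Proof. by have := ler_normD u v; rewrite !normCE -rmorphD /= lecR. Qed.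

Lemma modulusN u : modulus (- u) = modulus u.
Proof. by have := normrN u; rewrite !normCE => -[]. Qed.

Lemma modulusB u v : modulus (u - v) <= modulus u + modulus v.
Proof. by rewrite -(modulusN v) modulusD. Qed.

Lemma modulus_toC_ge (z : R * R) : `|z.1| <= modulus (toC z) /\ `|z.2| <= modulus (toC z).
Proof.
case: z => x y; rewrite /modulus /toC/=.
by split; rewrite -sqrtr_sqr ler_wsqrtr// ?lerDl ?lerDr ?sqr_ge0.
Qed.

Lemma modulus_toC_le (z : R * R) : modulus (toC z) <= `|z.1| + `|z.2|.
Proof.
case: z => x y; rewrite /modulus /toC/=.
rewrite -[leRHS]ger0_norm ?addr_ge0// -sqrtr_sqr ler_wsqrtr// sqrrD !real_normK ?num_real//.
by rewrite addrAC lerDl mulrn_wge0// mulr_ge0.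
Qed.

End Modulus.
Arguments modulus {R} w : simpl never.

(** * A chordal distance and the concentration of Moebius maps *)

Section Chord.
Context {R : realType}.
Notation C := (Cplx R).
Implicit Types (x y : sphere R) (A : 'M[Cplx R]_2).

Definition hom (x : sphere R) : C * C := if x is Some z then (z, 1) else (1, 0).

Definition wedge (X Y : C * C) : C := X.1 * Y.2 - X.2 * Y.1.

Definition size1 (X : C * C) : R := modulus X.1 + modulus X.2.

Definition mapply A (X : C * C) : C * C :=
  (A 0 0 * X.1 + A 0 1 * X.2, A 1 0 * X.1 + A 1 1 * X.2).

Definition scale2 (l : C) (X : C * C) : C * C := (l * X.1, l * X.2).

(** The chordal distance of CP^1 up to bounded factors: sine-type quotient in homogeneous
    coordinates, with the l^1-norm in place of the Hermitian one. The numerator is a determinant, so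
    a matrix acts on it by a scalar. *)
Definition chord x y : R :=
  modulus (wedge (hom x) (hom y)) / (size1 (hom x) * size1 (hom y)).

Lemma size1_ge0 X : 0 <= size1 X.
Proof. by rewrite addr_ge0 ?modulus_ge0. Qed.

Lemma size1_gt0 X : (0 < size1 X) = (X != (0, 0)).
Proof.
case: X => u v; rewrite lt0r size1_ge0 andbT /size1/= paddr_eq0 ?modulus_ge0//.
by rewrite !modulus_eq0 xpair_eqE.
Qed.

Lemma hom_neq0 x : hom x != (0, 0).
Proof. by case: x => [z|]; rewrite xpair_eqE /= oner_eq0 ?andbF. Qed.

Lemma size1_hom x : 0 < size1 (hom x). Proof. by rewrite size1_gt0 hom_neq0. Qed.

Lemma wedge_scale2 k l X Y : wedge (scale2 k X) (scale2 l Y) = k * l * wedge X Y.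
Proof. by rewrite /wedge/scale2/=; ring. Qed.

Lemma size1_scale2 k X : size1 (scale2 k X) = modulus k * size1 X.
Proof. by rewrite /size1/scale2/= !modulusM mulrDr. Qed.

Lemma wedge_mapply A X Y : wedge (mapply A X) (mapply A Y) = \det A * wedge X Y.
Proof. by rewrite det2E /wedge/mapply/=; ring. Qed.

Lemma mapply_neq0 A X : \det A != 0 -> X != (0, 0) -> mapply A X != (0, 0).
Proof.
case: X => u v; rewrite det2E => detA; apply: contra_neq; rewrite /mapply/= => -[h1 h2].
have e1 : (A 0 0 * A 1 1 - A 0 1 * A 1 0) * u = A 1 1 * (A 0 0 * u + A 0 1 * v) - A 0 1 * (A 1 0 * u + A 1 1 * v) by ring.
have e2 : (A 0 0 * A 1 1 - A 0 1 * A 1 0) * v = A 0 0 * (A 1 0 * u + A 1 1 * v) - A 1 0 * (A 0 0 * u + A 0 1 * v) by ring.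
move: e1 e2; rewrite h1 h2 !mulr0 subrr => /eqP + /eqP.
by rewrite !mulf_eq0 (negbTE detA)/= => /eqP -> /eqP ->.
Qed.

Lemma hom_moebius A x : \det A != 0 ->
  exists2 l, l != 0 & mapply A (hom x) = scale2 l (hom (moebius_mx A x)).
Proof.
move=> detA; have := mapply_neq0 detA (hom_neq0 x).
have -> : moebius_mx A x = let: (s, t) := mapply A (hom x) in if t == 0 then None else Some (s / t).
  by rewrite /moebius_mx /mapply /hom; case: x.
case: (mapply A (hom x)) => s t; rewrite xpair_eqE negb_and.
have [->|t0] := eqVneq t 0; rewrite ?orbF => h.
  by exists s; rewrite // /scale2/= mulr1 mulr0.
by exists t => //; rewrite /scale2/= mulr1 mulrC divfK.
Qed.

(** The scalars that relate [mapply A (hom x)] to the coordinates of the image cancel between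
    numerator and denominator. *)
Lemma chord_moebius A x y : \det A != 0 ->
  chord (moebius_mx A x) (moebius_mx A y) =
  modulus (\det A) * modulus (wedge (hom x) (hom y)) /
  (size1 (mapply A (hom x)) * size1 (mapply A (hom y))).
Proof.
move=> detA; have [k k0 hk] := hom_moebius x detA; have [l l0 hl] := hom_moebius y detA.
rewrite -modulusM -wedge_mapply hk hl wedge_scale2 !size1_scale2 !modulusM /chord.
have := size1_hom (moebius_mx A x); have := size1_hom (moebius_mx A y).
have mk : modulus k != 0 by rewrite modulus_eq0.
have ml : modulus l != 0 by rewrite modulus_eq0.
move=> h1 h2; field.
by rewrite mk ml !gt_eqF.
Qed.

Lemma chord_eq0 x y : chord x y = 0 -> x = y.
Proof.
move=> /eqP; rewrite mulf_eq0 invr_eq0 mulf_eq0 !(gt_eqF (size1_hom _))/= orbF modulus_eq0.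
rewrite /wedge; case: x y => [z|] [w|] //=; rewrite ?mulr1 ?mul1r ?mulr0 ?mul0r ?sub0r ?subr0 ?oppr_eq0 ?oner_eq0//.
by rewrite subr_eq0 => /eqP ->.
Qed.

Lemma chord_ge0 x y : 0 <= chord x y.
Proof. by rewrite divr_ge0 ?modulus_ge0// mulr_ge0// ltW// size1_hom. Qed.

Lemma wedge_le X Y : modulus (wedge X Y) <= size1 X * size1 Y.
Proof.
rewrite /wedge (le_trans (modulusB _ _))// !modulusM /size1.
have := modulus_ge0 X.1; have := modulus_ge0 X.2; have := modulus_ge0 Y.1; have := modulus_ge0 Y.2.
by nra.
Qed.

(* [E] consists of the directions on which [A] has norm less than [eta]. *)
Lemma moebius_concentration A (L eta : R) (i j : 'I_2) :
  \det A = 1 -> 0 < eta -> 0 < L -> L <= modulus (A i j) ->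
  exists E : set (sphere R),
    (forall x y, E x -> E y -> chord x y <= 2 * eta / L) /\
    (forall x y, ~ E x -> ~ E y ->
       chord (moebius_mx A x) (moebius_mx A y) <= eta ^- 2).
Proof.
move=> detA eta0 L0 LA.
exists [set x | size1 (mapply A (hom x)) < eta * size1 (hom x)]; split; last first.
  move=> x y /= /negP; rewrite -leNgt => hx /negP; rewrite -leNgt => hy.
  rewrite chord_moebius detA ?oner_eq0// modulus1 mul1r.
  have px := size1_hom x; have py := size1_hom y.
  have qx : 0 < size1 (mapply A (hom x)) by apply: lt_le_trans hx; rewrite mulr_gt0.
  have qy : 0 < size1 (mapply A (hom y)) by apply: lt_le_trans hy; rewrite mulr_gt0.
  rewrite ler_pdivrMr ?mulr_gt0// mulrC ler_pdivlMr ?exprn_gt0//.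
  apply: (@le_trans _ _ (size1 (hom x) * size1 (hom y) * eta ^+ 2)).
    by rewrite ler_wpM2r ?sqr_ge0// wedge_le.
  rewrite (_ : _ * _ * _ = (eta * size1 (hom x)) * (eta * size1 (hom y))); last by ring.
  by rewrite ler_pM// mulr_ge0// ltW.
move=> x y /= hx hy.
pose row X := A i 0 * X.1 + A i 1 * X.2 : C.
have rowle X : modulus (row X) <= size1 (mapply A X).
  rewrite /size1/mapply/row/=; case: i {LA row} => -[|[|//]] hi.
    rewrite (_ : Ordinal hi = 0) ?lerDl ?modulus_ge0//; exact/val_inj.
  rewrite (_ : Ordinal hi = 1) ?lerDr ?modulus_ge0//; exact/val_inj.
(* Cramer's rule: the entry times [wedge X Y] is a combination of [row X] and [row Y]. Two
   directions on which one row is small while an entry of it is large are therefore nearly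
   parallel. *)
have key X Y : modulus (A i j) * modulus (wedge X Y) <=
    modulus (row X) * size1 Y + modulus (row Y) * size1 X.
  rewrite -modulusM.
  have [e|e] : A i j * wedge X Y = row X * Y.2 - row Y * X.2 \/ A i j * wedge X Y = row Y * X.1 - row X * Y.1.
    rewrite /wedge/row; case: j {LA row rowle} => -[|[|//]] hj.
      by left; rewrite (_ : Ordinal hj = 0); [ring|exact/val_inj].
    by right; rewrite (_ : Ordinal hj = 1); [ring|exact/val_inj].
  - rewrite e (le_trans (modulusB _ _))// !modulusM lerD// ler_wpM2l ?modulus_ge0//.
      by rewrite lerDr modulus_ge0.
    by rewrite lerDr modulus_ge0.
  - rewrite e [leRHS]addrC (le_trans (modulusB _ _))// !modulusM lerD// ler_wpM2l ?modulus_ge0//.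
      by rewrite lerDl modulus_ge0.
    by rewrite lerDl modulus_ge0.
have px := size1_hom x; have py := size1_hom y.
rewrite /chord ler_pdivrMr ?mulr_gt0// mulrAC ler_pdivlMr// mulrC.
apply: (@le_trans _ _ (modulus (A i j) * modulus (wedge (hom x) (hom y)))).
  by rewrite ler_wpM2r ?modulus_ge0.
rewrite (le_trans (key _ _))//.
have h1 := le_lt_trans (rowle (hom x)) hx; have h2 := le_lt_trans (rowle (hom y)) hy.
by nra.
Qed.

End Chord.

(** * Close points in a common chart, and small oscillation *)

Section ChordCharts.
Context {R : realType}.
Notation C := (Cplx R).
Notation mu := (@lebesgue_measure R).
Notation mu2 := (mu \x mu)%E.
Implicit Types (x y : sphere R) (z : R * R) (r : R).

(** The inversion w -> 1/w of the sphere, which interchanges its two charts. *)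
Definition flip (x : sphere R) : sphere R :=
  if x is Some w then (if w == 0 then None else Some w^-1) else Some 0.

Lemma sphere_chartE b z :
  sphere_chart b z = if b then Some (toC z) else flip (Some (toC z)).
Proof. by case: b. Qed.

Lemma flipK : involutive flip.
Proof.
case=> [w|] /=; last by rewrite eqxx.
by have [->|w0] := eqVneq w 0; rewrite //= invr_eq0 (negbTE w0) invrK.
Qed.

(** Exchanging the homogeneous coordinates changes only the sign of [wedge] and keeps [size1]. *)
Lemma chord_flip x y : chord (flip x) (flip y) = chord x y.
Proof.
have H v : exists2 l : C, l != 0 & ((hom v).2, (hom v).1) = scale2 l (hom (flip v)).
  case: v => [w|] /=; last by exists 1; rewrite ?oner_eq0// /scale2/= mulr0 mulr1.
  have [->|w0] := eqVneq w 0.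
    by exists 1; rewrite ?oner_eq0// /scale2/= mulr0 mulr1.
  by exists w => //; rewrite /scale2/= mulr1 mulfV.
have [k k0 hk] := H x; have [l l0 hl] := H y.
have sw (X : C * C) : size1 (X.2, X.1) = size1 X by rewrite /size1/= addrC.
have ww (X Y : C * C) : modulus (wedge (X.2, X.1) (Y.2, Y.1)) = modulus (wedge X Y).
  by rewrite -modulusN; congr modulus; rewrite /wedge/=; ring.
rewrite [RHS]/chord -(sw (hom x)) -(sw (hom y)) -ww hk hl wedge_scale2 !size1_scale2 !modulusM /chord.
have := size1_hom (flip x); have := size1_hom (flip y).
have mk : modulus k != 0 by rewrite modulus_eq0.
have ml : modulus l != 0 by rewrite modulus_eq0.
by move=> h1 h2; field; rewrite mk ml !gt_eqF.
Qed.

Lemma flip_or x : exists2 b, exists w, modulus w <= 1 /\ (if b then x else flip x) = Some w & true.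
Proof.
case: x => [w|]; last first.
  by exists false => //; exists 0; rewrite modulus0 ler01.
have [w1|w1] := leP (modulus w) 1; first by exists true => //; exists w.
have w0 : w != 0 by rewrite -modulus_gt0 (lt_trans ltr01).
exists false => //; exists w^-1; rewrite /= (negbTE w0) modulusV; split => //.
by rewrite invf_le1 ?ltW// (lt_trans ltr01).
Qed.

(** With t = |w - w'|, the bound on [chord] gives t <= r * 2 * (t + 2), and r <= 1/32 turns this
    into t <= 64/15 * r, below 5r. The point at infinity is excluded: its chord to w is at least
    1/2. *)
Let chord_Some (w : C) y r : modulus w <= 1 -> r <= 1 / 32 -> chord (Some w) y <= r ->
  exists2 w', y = Some w' & modulus (w - w') <= 5 * r.
Proof.
move=> w1 r1; rewrite /chord ler_pdivrMr ?mulr_gt0 ?size1_hom//.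
case: y => [w'|]; rewrite /wedge/size1/= ?mulr1 ?mulr0 ?mul1r ?sub0r ?modulus1 ?modulus0 ?modulusN ?modulus1.
  move=> h; exists w' => //.
  have h1 : modulus w' <= modulus (w - w') + modulus w.
    rewrite -(modulusN (w - w')) (le_trans _ (modulusD _ _))//.
    by rewrite opprB subrK.
  have m0 := modulus_ge0 w'; have m1 := modulus_ge0 w; have m2 := modulus_ge0 (w - w').
  have r0 : 0 <= r.
    rewrite leNgt; apply/negP => rneg; move: h; apply/negP; rewrite -ltNge.
    by apply: lt_le_trans m2; rewrite nmulr_rlt0// mulr_gt0// ltr_wpDl.
  have h2 : modulus (w - w') <= r * (2 * (modulus (w - w') + 2)).
    apply: le_trans h _; rewrite ler_wpM2l// ler_pM//; lra.
  nra.
rewrite addr0 mulr1 => h; exfalso.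
have m1 := modulus_ge0 w; nra.
Qed.

(** The chart is the one in which x lies in the unit disc; y is then within 5/32 of it, hence still
    in the square of half-side 5/4. *)
Lemma chord_common_chart x y r : r <= 1 / 32 -> chord x y <= r ->
  exists b z z', [/\ x = sphere_chart b z, y = sphere_chart b z',
    square (5 / 4) z, square (5 / 4) z' &
    `|z.1 - z'.1| <= 5 * r /\ `|z.2 - z'.2| <= 5 * r].
Proof.
move=> r1 xy; have [b [w [w1 hx]] _] := flip_or x.
have hc : chord (if b then x else flip x) (if b then y else flip y) <= r.
  by case: (b); rewrite ?chord_flip.
rewrite hx in hc; have [w' hy ww'] := chord_Some w1 r1 hc.
have [z ez] := toC_surj w; have [z' ez'] := toC_surj w'.
exists b, z, z'.
have [m1 m2] := modulus_toC_ge z; have [m1' m2'] := modulus_toC_ge z'.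
rewrite -ez in m1 m2; rewrite -ez' in m1' m2'.
have mw' : modulus w' <= 5 / 4.
  have -> : w' = w - (w - w') by rewrite subKr.
  rewrite (le_trans (modulusB _ _))//; lra.
have e : w - w' = toC (z.1 - z'.1, z.2 - z'.2) by rewrite ez ez'.
have [m3 m4] := modulus_toC_ge (z.1 - z'.1, z.2 - z'.2); rewrite -e /= in m3 m4.
split.
- by rewrite sphere_chartE -ez -hx; case: (b); rewrite ?flipK.
- by rewrite sphere_chartE -ez' -hy; case: (b); rewrite ?flipK.
- by split; lra.
- by split; lra.
- by split; lra.
Qed.

Lemma sphere_chart_surj x : exists b z, x = sphere_chart b z /\ square (5 / 4) z.
Proof.
have [b [w [w1 hx]] _] := flip_or x; have [z ez] := toC_surj w.
exists b, z; have [m1 m2] := modulus_toC_ge z; rewrite -ez in m1 m2.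
split; last by split; lra.
by rewrite sphere_chartE -ez -hx; case: (b); rewrite ?flipK.
Qed.

Lemma toC_inj : injective (@toC R).
Proof. by move=> [a b] [c d] []/= -> ->. Qed.

Lemma ae_sphere_charts (D_ : bool -> R * R -> Prop) :
  (forall b, {ae mu2, forall z, D_ b z}) ->
  ae_sphere (fun x => forall b z, x = sphere_chart b z -> D_ b z).
Proof.
move=> hD; apply/ae_sphereP.
apply: ae_weaken (ae_and (hD true) (ae_preserving_plane_inv (hD false))) => z [h1 h2].
move=> [] z'; rewrite sphere_chartE /=; first by move=> /Some_inj /toC_inj <-.
case: ifPn => // z0 /Some_inj h; suff -> : z' = plane_inv z by [].
by apply: toC_inj; rewrite toC_plane_inv h invrK.
Qed.

Lemma ae_sphere_squares (P : sphere R -> Prop) :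
  (forall b, {ae mu2, forall z, square (5 / 4) z -> P (sphere_chart b z)}) -> ae_sphere P.
Proof.
move=> hP; apply: ae_sphere_weaken (ae_sphere_charts hP) => x hx.
have [b [z [ez zQ]]] := sphere_chart_surj x.
by rewrite ez; exact: hx.
Qed.

(* Three points at pairwise distance larger than the diameter of [E] cannot
   all be in [E]; hence the values of [F] at two fixed points determine [F]. *)
Lemma ae_constant_of_small_oscillation (m : nat) (F : sphere R -> 'rV[R]_m) :
  (forall e : R, 0 < e -> exists D E : set (sphere R), [/\ ae_sphere D,
     forall x y, E x -> E y -> chord x y <= e &
     forall x y, D x -> D y -> ~ E x -> ~ E y ->
       forall i, `|F x 0 i - F y 0 i| <= e]) ->
  exists q, ae_sphere (fun x => F x = q).
Proof.
move=> hF.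
have hF' (n : nat) : exists DE : set (sphere R) * set (sphere R), [/\ ae_sphere DE.1,
     forall x y, DE.2 x -> DE.2 y -> chord x y <= n.+1%:R^-1 &
     forall x y, DE.1 x -> DE.1 y -> ~ DE.2 x -> ~ DE.2 y ->
       forall i, `|F x 0 i - F y 0 i| <= n.+1%:R^-1].
  have [|D [E [h1 h2 h3]]] := hF n.+1%:R^-1; first by rewrite invr_gt0.
  by exists (D, E).
have [DE hDE] := choice hF'.
pose D x := forall n, (DE n).1 x.
have aD : ae_sphere D by apply: ae_sphere_bigcap => n; have [] := hDE n.
have small (e : R) : 0 < e -> \forall n \near \oo, n.+1%:R^-1 < e.
  by move=> e0; near=> n; near: n; exact: near_infty_natSinv_lt (PosNum e0).
(* Distinct points have positive chord, which eventually exceeds the bound 1/(n+1) on the diameter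
   of the exceptional set. *)
have sep x y : x <> y -> \forall n \near \oo, ~ ((DE n).2 x /\ (DE n).2 y).
  move=> xy; have c0 : 0 < chord x y.
    rewrite lt0r chord_ge0 andbT; apply/eqP => /chord_eq0; exact: xy.
  apply: filterS (small _ c0) => n hn [Ex Ey]; have [_ h _] := hDE n.
  by move: (h _ _ Ex Ey); rewrite leNgt hn.
have eqF x y : (forall N, exists2 n, (N <= n)%N & forall i, `|F x 0 i - F y 0 i| <= n.+1%:R^-1) -> F x = F y.
  move=> h; apply/rowP => i; apply/eqP; rewrite -subr_eq0 -normr_eq0; apply/eqP.
  apply/le_anti; rewrite normr_ge0 andbT leNgt; apply/negP => e0.
  have [N _ hN] := small _ e0; have [n Nn hn] := h N.
  by have := lt_le_trans (hN _ Nn) (hn i); rewrite ltxx.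
have [[p1 [p2 [D1 D2 Fp]]]|cst] := pselect (exists p1 p2, [/\ D p1, D p2 & F p1 <> F p2]); last first.
  have [x Dx] := ae_sphere_ex aD; exists (F x).
  apply: ae_sphere_weaken aD => y Dy; apply: contrapT => h; apply: cst.
  by exists y, x.
have p12 : p1 <> p2 by move=> h; apply: Fp; rewrite h.
have aD' := ae_sphere_and aD (ae_sphere_and (ae_sphere_neq p1) (ae_sphere_neq p2)).
have [x0 [Dx0 [x01 x02]]] := ae_sphere_ex aD'; exists (F x0).
(* eventually one of p1, p2 is in E n, so any other point is not *)
have one : \forall n \near \oo, (DE n).2 p1 \/ (DE n).2 p2.
  apply: contrapT => h; apply: Fp; apply: eqF => N.
  apply: contrapT => h2; apply: h; exists N => // n /= Nn.
  apply: contrapT => h3; apply: h2; exists n => // i.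
  have [_ _ hn] := hDE n; apply: hn; [exact: D1|exact: D2| |]; tauto.
have out x : x <> p1 -> x <> p2 -> \forall n \near \oo, ~ (DE n).2 x.
  move=> x1 x2; apply: filterS3 one (sep _ _ x1) (sep _ _ x2) => n; tauto.
apply: ae_sphere_weaken aD' => x [Dx [x1 x2]]; apply: eqF => N.
have [M _ hM] : \forall n \near \oo, ~ (DE n).2 x /\ ~ (DE n).2 x0.
  by apply: filterS2 (out _ x1 x2) (out _ x01 x02) => n ? ?; split.
exists (maxn N M); first exact: leq_maxl.
have [h1 h2] := hM (maxn N M) (leq_maxr _ _).
have [_ _ hn] := hDE (maxn N M); exact: hn.
Unshelve. all: by end_near.
Qed.

End ChordCharts.

(** * Compact subsets of the groups *)

(** A cluster point in the ambient space lies in the image of [S], and neighbourhoods in the subtype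
    are traces of ambient ones. *)
Lemma compact_set_val (X : topologicalType) (A : set X) (S : set A) :
  compact (set_val @` S) -> compact S.
Proof.
move=> cS F FF FS.
have [_ [[s Ss <-] cl]] := cS _ (fmap_proper_filter set_val FF)
  (filterS (fun x Sx => ex_intro2 _ _ x Sx erefl) FS).
exists s; split => // B U FB.
rewrite nbhsE => -[_ [[V oV <-] /= Vs] VU].
have nV : nbhs (set_val s) V by exact: open_nbhs_nbhs.
have FvB : F (set_val @^-1` (set_val @` B)) by apply: filterS FB => x Bx; exists x.
have [_ [[b Bb <-] Vb]] := cl _ _ FvB nV.
by exists b; split => //; exact: VU.
Qed.

Section CompactSubsets.
Context {R : realType}.
Local Open Scope quotient_scope.
Notation C := (Cplx R).
Implicit Types (M : 'M[Cplx R]_2) (x : sphere R).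

Definition box (L : R) : set C := [set toC z | z in square L].

Lemma continuous_toC : continuous (@toC R).
Proof.
move=> z; apply/cvgrPdist_lt => e e0.
have [e1 ee] : exists e1 : R, e = (e1%:C)%C.
  by exists (complex.Re e); case: e e0 => a b; rewrite ltcE/= => /andP[/eqP -> _].
have {e0}e10 : 0 < e1 by move: e0; rewrite ee ltcR.
have e2 : 0 < e1 / 2 by rewrite divr_gt0.
have h1 : \forall t \near z, `|z.1 - t.1| < e1 / 2.
  by apply: (@cvgr_dist_lt _ _ _ (nbhs z) _ fst); [exact: cvg_fst|].
have h2 : \forall t \near z, `|z.2 - t.2| < e1 / 2.
  by apply: (@cvgr_dist_lt _ _ _ (nbhs z) _ snd); [exact: cvg_snd|].
rewrite ee; near=> t; rewrite normCE ltcR.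
have -> : toC z - toC t = toC (z.1 - t.1, z.2 - t.2) by [].
rewrite (le_lt_trans (modulus_toC_le _))//=.
have l1 : `|z.1 - t.1| < e1 / 2 by near: t.
have l2 : `|z.2 - t.2| < e1 / 2 by near: t.
lra.
Unshelve. all: by end_near.
Qed.

Lemma compact_box L : compact (box L).
Proof.
apply: continuous_compact; last exact: compact_square.
by apply: continuous_subspaceT; exact: continuous_toC.
Qed.

Lemma not_box L (w : C) : ~ box L w -> L < modulus w.
Proof.
have [z ->] := toC_surj w => nb; rewrite ltNge; apply/negP => h; apply: nb.
have [h1 h2] := modulus_toC_ge z.
by exists z => //; split; exact: le_trans h.
Qed.

Definition mx_of4 (q : (C * C) * (C * C)) : 'M[C]_2 :=
  \matrix_(i, j) (if i == 0 then (if j == 0 then q.1.1 else q.1.2)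
                  else (if j == 0 then q.2.1 else q.2.2)).

Lemma continuous_mx_of4 : continuous mx_of4.
Proof.
move=> q; apply/cvg_ballP => e e0.
have c11 : \forall q' \near q, ball q.1.1 e q'.1.1.
  apply: (@cvg_ball _ _ _ (nbhs q) _ (fun q' => q'.1.1)) => //.
  by apply: (@cvg_comp _ _ _ fst fst _ (nbhs q.1)); exact: cvg_fst.
have c12 : \forall q' \near q, ball q.1.2 e q'.1.2.
  apply: (@cvg_ball _ _ _ (nbhs q) _ (fun q' => q'.1.2)) => //.
  by apply: (@cvg_comp _ _ _ fst snd _ (nbhs q.1)); [exact: cvg_fst|exact: cvg_snd].
have c21 : \forall q' \near q, ball q.2.1 e q'.2.1.
  apply: (@cvg_ball _ _ _ (nbhs q) _ (fun q' => q'.2.1)) => //.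
  by apply: (@cvg_comp _ _ _ snd fst _ (nbhs q.2)); [exact: cvg_snd|exact: cvg_fst].
have c22 : \forall q' \near q, ball q.2.2 e q'.2.2.
  apply: (@cvg_ball _ _ _ (nbhs q) _ (fun q' => q'.2.2)) => //.
  by apply: (@cvg_comp _ _ _ snd snd _ (nbhs q.2)); exact: cvg_snd.
apply: filterS2 (filterI c11 c12) (filterI c21 c22) => q' [h1 h2] [h3 h4].
by split=> // i j; rewrite !mxE; case: ifP => _; case: ifP.
Qed.

Lemma compact_mx_box L : compact [set M : 'M[C]_2 | forall i j, box L (M i j)].
Proof.
have -> : [set M : 'M[C]_2 | forall i j, box L (M i j)] =
    mx_of4 @` ((box L `*` box L) `*` (box L `*` box L)).
  apply/seteqP; split => [M hM|_ [q [[h1 h2] [h3 h4]] <-] i j]; last first.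
    by rewrite mxE; case: ifP => _; case: ifP.
  exists ((M 0 0, M 0 1), (M 1 0, M 1 1)); first by split; split; exact: hM.
  apply/matrixP => i j; rewrite mxE.
  case: i => -[|[|//]] hi; case: j => -[|[|//]] hj /=; congr (M _ _); exact/val_inj.
apply: continuous_compact; first by apply: continuous_subspaceT; exact: continuous_mx_of4.
by do 2! apply: compact_setX; exact: compact_box.
Qed.

Lemma closed_eq (f : 'M[C]_2 -> C) (w : C) : continuous f -> closed [set M | f M = w].
Proof.
move=> cf; apply: (@closed_comp _ _ f [set w]); first by move=> M _; exact: cf.
by apply: accessible_closed_set1; apply: hausdorff_accessible; exact: norm_hausdorff.
Qed.

(** Zero exactly when the line of [hom x] is invariant under [M]. It is continuous in the entries,
    so fixing x becomes a closed condition on matrices. *)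
Definition fix_form x M : C := wedge (mapply M (hom x)) (hom x).

Lemma fix_formP x M : \det M != 0 -> fix_form x M = 0 <-> moebius_mx M x = x.
Proof.
move=> dM; have [l l0 hl] := hom_moebius x dM.
rewrite /fix_form hl (_ : wedge _ _ = l * wedge (hom (moebius_mx M x)) (hom x)); last first.
  by rewrite /wedge/scale2/=; ring.
split=> [/eqP|->]; last by rewrite /wedge mulrC [X in X - _]mulrC subrr mul0r.
rewrite mulf_eq0 (negbTE l0)/= => /eqP h.
by apply: chord_eq0; rewrite /chord h modulus0 mul0r.
Qed.

Lemma continuous_fix_form x : continuous (fix_form x).
Proof.
move=> M; have c i j : (fun M' : 'M[C]_2 => M' i j) @ M --> M i j by exact: coord_continuous.
have d i (a b : C) : (fun M' : 'M[C]_2 => M' i 0 * a + M' i 1 * b) @ M --> M i 0 * a + M i 1 * b.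
  apply: (@cvgD _ _ _ (nbhs M) _ (fun M' : 'M[C]_2 => M' i 0 * a)).
    exact: (@cvgMl _ _ (nbhs M) _ (fun M' : 'M[C]_2 => M' i 0)).
  exact: (@cvgMl _ _ (nbhs M) _ (fun M' : 'M[C]_2 => M' i 1)).
apply: (@cvgB _ _ _ (nbhs M) _ (fun M' : 'M[C]_2 => (M' 0 0 * (hom x).1 + M' 0 1 * (hom x).2) * (hom x).2)).
  exact: (@cvgMl _ _ (nbhs M) _ (fun M' : 'M[C]_2 => M' 0 0 * (hom x).1 + M' 0 1 * (hom x).2)).
exact: (@cvgMl _ _ (nbhs M) _ (fun M' : 'M[C]_2 => M' 1 0 * (hom x).1 + M' 1 1 * (hom x).2)).
Qed.

Lemma continuous_det2 : continuous (fun M : 'M[C]_2 => \det M).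
Proof.
rewrite (_ : (fun M => \det M) = (fun M : 'M[C]_2 => M 0 0 * M 1 1 - M 0 1 * M 1 0)).
  2: by apply/funext => M; rewrite det2E.
move=> M; have c i j : (fun M' : 'M[C]_2 => M' i j) @ M --> M i j by exact: coord_continuous.
apply: (@cvgB _ _ _ (nbhs M) _ (fun M' : 'M[C]_2 => M' 0 0 * M' 1 1)).
  exact: (@cvgM _ _ (nbhs M) _ (fun M' : 'M[C]_2 => M' 0 0)).
exact: (@cvgM _ _ (nbhs M) _ (fun M' : 'M[C]_2 => M' 0 1)).
Qed.

Definition bounded_SL2 (L : R) (Z : set 'M[C]_2) : set (@SL2 R) :=
  [set A : @SL2 R | (forall i j, box L ((val A : 'M[C]_2) i j)) /\ Z (val A)].

Lemma compact_bounded_SL2 L (Z : set 'M[C]_2) : closed Z -> compact (bounded_SL2 L Z).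
Proof.
move=> cZ; apply: compact_set_val.
have -> : set_val @` bounded_SL2 L Z =
    [set M : 'M[C]_2 | forall i j, box L (M i j)] `&` ([set M | \det M = 1] `&` Z).
  apply/seteqP; split => [_ [A [h1 h2] <-]|M [h1 [h2 h3]]].
    split; first exact: h1.
    by split; [exact: (set_valP A)|exact: h2].
  have h : (M \in @SL2 R) by rewrite inE.
  by exists (exist _ M h).
apply: compact_closedI; first exact: compact_mx_box.
by apply: closedI => //; apply: closed_eq; exact: continuous_det2.
Qed.

Definition bounded_PSL2 L Z : set (PSL2 R) := \pi_(PSL2 R) @` bounded_SL2 L Z.

Lemma compact_bounded_PSL2 L (Z : set 'M[C]_2) : closed Z -> compact (bounded_PSL2 L Z).
Proof.
move=> cZ; apply: continuous_compact; last exact: compact_bounded_SL2.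
by apply: continuous_subspaceT; exact: pi_continuous.
Qed.

Lemma det_SL2 (A : @SL2 R) : \det (val A : 'M[C]_2) = 1.
Proof. exact: (set_valP A). Qed.

Lemma det_SL2_neq0 (A : @SL2 R) : \det (val A : 'M[C]_2) != 0.
Proof. by rewrite det_SL2 oner_neq0. Qed.

Lemma exists_compact_subgroup_part x1 x2 (G : set (PSL2 R)) L :
  [\/ G = G0 R, G = G1 x1 | G = G2 x1 x2] ->
  exists2 K : set (PSL2 R), compact K /\ K `<=` G &
    forall g, (G `\` K) g -> exists i j, L < modulus ((val (repr g) : 'M[C]_2) i j).
Proof.
move=> hG.
(* In all three cases the lift of [G] to SL2 is cut out by a closed set of matrices, so intersecting
   with bounded entries gives a compact set. *)
have [Z cZ hZ] : exists2 Z : set 'M[C]_2, closed Z &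
    forall A : @SL2 R, G (\pi_(PSL2 R) A) <-> Z (val A).
  have cx x : closed [set M | fix_form x M = 0].
    by apply: closed_eq; exact: continuous_fix_form.
  have fx x (A : @SL2 R) : moebius (\pi_(PSL2 R) A) x = x <-> fix_form x (val A) = 0.
    by rewrite moebius_pi; split=> h; apply/(fix_formP x (det_SL2_neq0 A)).
  case: hG => ->.
  - by exists setT; [exact: closedT|].
  - by exists [set M | fix_form x1 M = 0] => // A; exact: fx.
  - exists ([set M | fix_form x1 M = 0] `&` [set M | fix_form x2 M = 0]).
      exact: closedI.
    by move=> A; split=> -[h1 h2]; split; apply/fx.
exists (bounded_PSL2 L Z); first split; first exact: compact_bounded_PSL2.
  by move=> _ [A [_ ZA] <-]; apply/hZ.
move=> g [Gg nK]; apply: contrapT => hn; apply: nK.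
exists (repr g); last by rewrite reprK.
split; last by apply/hZ; rewrite reprK.
by move=> i j; apply: contrapT => /not_box h; apply: hn; exists i, j.
Qed.

End CompactSubsets.

(** * Weak derivatives of a difference *)

Section WeakDerivativeDifference.
Context {R : realType}.
Notation RR := (measurableTypeR R * measurableTypeR R)%type.
Notation mu := (@lebesgue_measure R).
Notation mu2 := (mu \x mu)%E.
Implicit Types (Omega K : set (R * R)) (u v phi g : R * R -> R).

(** The sigma-algebra is generated by rectangles, so an open set is written as the countable union
    of the rational squares that it contains. *)
Lemma open_measurable_plane (U : set (R * R)) : open U -> measurable (U : set RR).
Proof.
move=> oU; pose B (q r s : rat) : set RR :=
  if `[< ball (ratr q : R) (ratr s) `*` ball (ratr r : R) (ratr s) `<=` U >]
  then ball (ratr q : R) (ratr s) `*` ball (ratr r : R) (ratr s) else set0.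
have -> : U = \bigcup_q \bigcup_r \bigcup_s B q r s.
  apply/seteqP; split => [z Uz|z [q _ [r _ [s _]]]]; last first.
    by rewrite /B; case: asboolP => // h; exact: h.
  have /nbhs_ballP[e /= e0 he] : nbhs z U by exact: open_nbhs_nbhs.
  have e3 : 0 < e / 3 by rewrite divr_gt0.
  (* A square of radius below e/2 that contains z stays within e of z in each coordinate. *)
  have e23 : e / 3 < e / 2 by lra.
  have [s] := rat_in_itvoo e23; rewrite in_itv/= => /andP[s1 s2].
  have s0 : 0 < ratr s :> R by exact: lt_trans s1.
  have h (x : R) : exists q : rat, ball (ratr q : R) (ratr s) x.
    have [q] : exists q : rat, ratr q \in `]x - ratr s, x + ratr s[.
      by apply: rat_in_itvoo; lra.
    rewrite in_itv/= => /andP[q1 q2]; exists q.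
    by rewrite -ball_normE/= ltr_norml; apply/andP; split; lra.
  have [q hq] := h z.1; have [r hr] := h z.2.
  exists q => //; exists r => //; exists s => //; rewrite /B; case: asboolP => // nB.
  exfalso; apply: nB => w [w1 w2]; apply: he.
  have t (x y c : R) : ball c (ratr s) x -> ball c (ratr s) y -> ball x e y.
    rewrite -!ball_normE/= !ltr_norml => /andP[? ?] /andP[? ?].
    by apply/andP; split; lra.
  by split; [exact: t hq w1|exact: t hr w2].
do 3! apply: bigcupT_measurable_rat => ?.
by rewrite /B; case: asboolP => // _; apply: measurableX; exact: measurable_ball.
Qed.

Lemma compact_measurable_plane K : compact K -> measurable (K : set RR).
Proof.
move=> /compact_closed cK; rewrite -[K]setCK; apply: measurableC.
apply: open_measurable_plane; apply: closed_openC; apply: cK.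
exact: norm_hausdorff.
Qed.

Lemma continuous_measurable_plane g : continuous g -> measurable_fun [set: RR] g.
Proof.
move=> /continuousP cg; apply: (measurability _ (RGenOpens.measurableE R)).
move=> _ [_ [a [b ->] <-]]; rewrite setTI.
by apply: open_measurable_plane; apply: cg; exact: interval_open.
Qed.

Lemma integrableM_continuous K u g : compact K -> continuous g ->
  mu2.-integrable K (EFin \o u) -> mu2.-integrable K (EFin \o (fun z => u z * g z)).
Proof.
move=> cK cg iu; have mK := compact_measurable_plane cK.
apply: (@integrableMl _ _ _ mu2 _ mK _ g iu).
  by apply: measurable_funTS; exact: continuous_measurable_plane.
have /compact_bounded[M [Mr hM]] : compact (g @` K).
  by apply: continuous_compact => //; exact: continuous_subspaceT.
exists M; split => // x Mx z Kz; apply: (hM x Mx).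
by exists z.
Qed.

Lemma foldr_partial a b phi : partial a b phi =
  foldr (fun w (g : R * R -> R^o) => 'D_w g)
    (phi : R * R -> R^o) (nseq a (1, 0) ++ nseq b (0, 1)).
Proof.
rewrite foldr_cat /partial.
have E n w (f : R * R -> R^o) :
    iter n (fun g : R * R -> R^o => 'D_w g) f = foldr (fun w g => 'D_w g) f (nseq n w).
  by elim: n => //= n ->.
by rewrite -!E.
Qed.

Lemma continuous_partial a b phi : smooth_on [set: R * R] (phi : R * R -> R^o) ->
  continuous (partial a b phi).
Proof.
move=> sphi z; rewrite foldr_partial.
exact: differentiable_continuous (sphi _ z I).
Qed.

Lemma partial_eq0 a b K phi z : closed K -> (forall z, ~ K z -> phi z = 0) ->
  ~ K z -> partial a b phi z = 0.
Proof.
move=> cK phi0; rewrite foldr_partial; set s := _ ++ _; elim: s z => [|w s IH] z Kz /=.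
  exact: phi0.
rewrite (@near_eq_derive _ _ _ _ (cst 0)) ?derive_cst//.
near=> t; apply: IH; near: t.
by apply: open_nbhs_nbhs; split => //; exact: closed_openC.
Unshelve. all: by end_near. Qed.

Lemma loc_integrableB Omega u v : loc_integrable Omega u -> loc_integrable Omega v ->
  loc_integrable Omega (fun z => u z - v z).
Proof.
move=> hu hv K cK KO.
exact: (integrableB (compact_measurable_plane cK) (hu K cK KO) (hv K cK KO)).
Qed.

(** [U_] measures a difference of maps, whose weak derivatives must therefore exist. The integrals
    over [Omega] are first reduced to the compact support of the test function, where local
    integrability allows them to be split. *)
Lemma is_weak_derivativeB Omega a b u1 u2 v1 v2 :
    is_weak_derivative Omega a b u1 v1 -> is_weak_derivative Omega a b u2 v2 ->
  is_weak_derivative Omega a b (fun z => u1 z - u2 z) (fun z => v1 z - v2 z).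
Proof.
move=> [u1i v1i h1] [u2i v2i h2]; split; [exact: loc_integrableB..|].
move=> phi tphi; have [sphi [K [cK KO phi0]]] := tphi.
have clK : closed K by apply: compact_closed => //; exact: norm_hausdorff.
have E g w1 w2 : continuous g -> (forall z, ~ K z -> g z = 0) ->
    loc_integrable Omega w1 -> loc_integrable Omega w2 ->
    \int[lebesgue2]_(z in Omega) ((w1 z - w2 z) * g z) =
    \int[lebesgue2]_(z in Omega) (w1 z * g z) - \int[lebesgue2]_(z in Omega) (w2 z * g z).
  move=> cg g0 i1 i2.
  have F w : \int[lebesgue2]_(z in Omega) (w z * g z) = \int[mu2]_(z in K) (w z * g z).
    by apply: Rintegral_eq_subset => // z _ Kz; rewrite g0// mulr0.
  rewrite !F -RintegralB.
  - by congr Rintegral; apply/funext => z; rewrite mulrBl.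
  - exact: compact_measurable_plane.
  - by apply: integrableM_continuous => //; exact: i1.
  - by apply: integrableM_continuous => //; exact: i2.
rewrite !E//; last 2 first.
- exact: continuous_partial.
- by move=> z; exact: partial_eq0.
by rewrite h1// h2// mulrBr.
by move=> z; exact: differentiable_continuous (sphi [::] z I).
Qed.

End WeakDerivativeDifference.

(** * Sobolev maps on the sphere and their reparametrizations *)

Section ReparametrizedMaps.
Context {R : realType}.
Implicit Types (p eps delta : R) (x y : sphere R).

Lemma ae_sphere_forall_ord m (P : 'I_m -> sphere R -> Prop) :
  (forall i, ae_sphere (P i)) -> ae_sphere (fun x => forall i, P i x).
Proof.
move=> hP.
have : ae_sphere (fun x => forall n (nm : (n < m)%N), P (Ordinal nm) x).
  apply: ae_sphere_bigcap => n; have [nm|nm] := pselect (n < m)%N.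
    by apply: ae_sphere_weaken (hP (Ordinal nm)) => x Px nm'; rewrite (bool_irrelevance nm' nm).
  by move=> b; apply: aeW => z nm'; case: (nm nm').
by apply: ae_sphere_weaken => x h [n nm]; exact: h.
Qed.

Lemma le_sphere_sobolev_norm m k p (F : sphere R -> 'rV[R]_m) b i :
  (sobolev_norm k p disc (fun z => F (sphere_chart b z) 0%R i) <= sphere_sobolev_norm k p F)%E.
Proof.
have s0 b' i' : (0 <= sobolev_norm k p disc (fun z => F (sphere_chart b' z) 0%R i'))%E.
  by apply: sume_ge0 => ab _; exact: Lnorm_ge0.
rewrite /sphere_sobolev_norm (bigD1 b)//= (bigD1 i)//= -addeA leeDl//.
by apply: adde_ge0; [|apply: sume_ge0 => b' _]; exact: sume_ge0.
Qed.

Lemma sphere_sobolev_ae_le : exists2 C : R, 0 < C &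
  forall m k p eps (F : sphere R -> 'rV[R]_m), (2 <= k)%N -> 1 <= p -> 0 < eps ->
    (forall b i, weakly_differentiable k disc (fun z => F (sphere_chart b z) 0 i)) ->
    (sphere_sobolev_norm k p F < eps%:E)%E ->
    ae_sphere (fun x => forall i, `|F x 0 i| <= C * eps).
Proof.
have [C C0 hC] := @sobolev_ae_le R; exists C => // m k p eps F k2 p1 e0 dF hF.
apply: ae_sphere_forall_ord => i; apply: ae_sphere_squares => b.
apply: (hC k p eps _ k2 p1 e0 (dF b i)).
exact: le_lt_trans (le_sphere_sobolev_norm _ _ _ _ _) hF.
Qed.

Lemma sphere_sobolev_unif_continuous m k p delta (F : sphere R -> 'rV[R]_m) :
    (2 <= k)%N -> sphere_sobolev k p F -> 0 < delta ->
  exists2 r : R, 0 < r & exists2 D : set (sphere R), ae_sphere D &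
    forall x y, D x -> D y -> chord x y <= r -> forall i, `|F x 0 i - F y 0 i| <= delta.
Proof.
move=> k2 SF d0.
pose good (bi : bool * 'I_m) (rD : R * set (R * R)) :=
  [/\ 0 < rD.1, {ae (@lebesgue2 R), forall z, rD.2 z} &
    forall z z', rD.2 z -> rD.2 z' -> square (5 / 4) z -> square (5 / 4) z' ->
      `|z.1 - z'.1| <= rD.1 -> `|z.2 - z'.2| <= rD.1 ->
      `|F (sphere_chart bi.1 z) 0 bi.2 - F (sphere_chart bi.1 z') 0 bi.2| <= delta].
have /choice[rD hrD] bi : exists rD, good bi rD.
  case: bi => b i.
  have [r r0 [D aD hD]] := ae_unif_continuous k2 (sobolev_weakly_differentiable (SF b i)) d0.
  by exists (r, D).
(* One radius for both charts and all coordinates; the 1 keeps it positive even when there are no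
   coordinates. *)
pose rho := \big[Order.min/1]_bi (rD bi).1.
have rho0 : 0 < rho by apply: lt_bigmin => // bi _; have [] := hrD bi.
have rho_le bi : rho <= (rD bi).1 by exact: bigmin_le.
(* 1/32 is the range of [chord_common_chart], and 5 the factor by which chart coordinates may exceed
   the chord. *)
exists (Num.min (1 / 32) (rho / 5)); first by rewrite lt_min !divr_gt0.
exists (fun x => forall i b z, x = sphere_chart b z -> (rD (b, i)).2 z).
  apply: ae_sphere_forall_ord => i; apply: (@ae_sphere_charts _ (fun b => (rD (b, i)).2)) => b.
  by have [] := hrD (b, i).
move=> x y Dx Dy; rewrite le_min => /andP[c1 c2] i.
have [] := @chord_common_chart R x y (Num.min (1 / 32) (rho / 5)).
- by rewrite ge_min lexx.
- by rewrite le_min c1.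
move=> b [z [z' [ez ez' zQ zQ' [h1 h2]]]].
have hr : 5 * Num.min (1 / 32) (rho / 5) <= (rD (b, i)).1.
  apply: le_trans (rho_le (b, i)).
  have : Num.min (1 / 32) (rho / 5) <= rho / 5 by rewrite ge_min lexx orbT.
  by move: (Num.min _ _) => t; lra.
have [_ _ h] := hrD (b, i); rewrite ez ez'; apply: h => //.
- exact: Dx ez.
- exact: Dy ez'.
- exact: le_trans hr.
- exact: le_trans hr.
Qed.

(** Here a, b, c are values of h \o g, f1 \o g and f2 at one point, and the primed letters those at
    another. The budget is 4 * e/8 + e/2 = e. *)
Lemma dist_chain_le (a a' b b' c c' e : R) :
  `|a - c| <= e / 8 -> `|a' - c'| <= e / 8 -> `|a - b| <= e / 8 -> `|a' - b'| <= e / 8 ->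
  `|b - b'| <= e / 2 -> `|c - c'| <= e.
Proof.
rewrite !ler_norml => /andP[? ?] /andP[? ?] /andP[? ?] /andP[? ?] /andP[? ?].
by apply/andP; split; lra.
Qed.

Context {M : topologicalType} {m : nat}.
Context (iota : M -> 'rV[R]_m) (k : nat) (p : R).
Context (iota_inj : injective iota) (k2 : (2 <= k)%N) (p1 : 1 <= p).
Implicit Types f h : sphere R -> M.

(** The contrapositive of [ae_constant_of_small_oscillation]; injectivity of [iota] brings constancy
    back to [M]. *)
Lemma nonconstant_oscillation f : nonconstant_map iota k p f ->
  exists2 e : R, 0 < e & forall D E : set (sphere R), ae_sphere D ->
    (forall x y, E x -> E y -> chord x y <= e) ->
    ~ (forall x y, D x -> D y -> ~ E x -> ~ E y ->
         forall i, `|iota (f x) 0 i - iota (f y) 0 i| <= e).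
Proof.
move=> [_ nc]; apply: contrapT => h; apply: nc.
have [e e0|q hq] := @ae_constant_of_small_oscillation R m (iota \o f).
  apply: contrapT => h2; apply: h; exists e => // D E aD hE hDE; apply: h2.
  by exists D, E.
have [x hx] := ae_sphere_ex hq; exists (f x).
by apply: ae_sphere_weaken hq => y; rewrite -hx; exact: iota_inj.
Qed.

Lemma U_ae_le : exists2 C : R, 0 < C & forall eps f h, 0 < eps ->
  is_map iota k p f -> U_ iota k p eps f h ->
  ae_sphere (fun x => forall i, `|iota (h x) 0 i - iota (f x) 0 i| <= C * eps).
Proof.
have [C C0 hC] := sphere_sobolev_ae_le; exists C => // eps f h e0 Sf [[Sh _] hN].
have dF b i : weakly_differentiable k disc
    (fun z => (iota (h (sphere_chart b z)) - iota (f (sphere_chart b z))) 0 i).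
  move=> a c ac; have [v hv _] := Sh b i a c ac; have [w hw _] := Sf b i a c ac.
  exists (fun z => v z - w z); have := is_weak_derivativeB hv hw.
  by congr is_weak_derivative; apply/funext => z; rewrite !mxE.
apply: ae_sphere_weaken (hC m k p eps _ k2 p1 e0 dF hN) => x hx i.
by have := hx i; rewrite !mxE.
Qed.

(** The claim covers all radii up to [eps], so that the two directions of the theorem, which give
    different bounds, can use their minimum. *)
Lemma properness_half x1 x2 (G : set (PSL2 R)) f1 f2 :
    [\/ G = G0 R, G = G1 x1 | G = G2 x1 x2] ->
    nonconstant_map iota k p f1 -> nonconstant_map iota k p f2 ->
  exists2 eps, 0 < eps & exists2 K : set (PSL2 R), compact K /\ K `<=` G &
    forall eps1 eps2 h g, 0 < eps1 <= eps -> 0 < eps2 <= eps -> U_ iota k p eps1 f1 h ->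
      (G `\` K) g -> ~ U_ iota k p eps2 f2 (h \o moebius g).
Proof.
move=> hG [Sf1 _] nf2; have [Sf2 _] := nf2.
have [e e0 he] := nonconstant_oscillation nf2.
have [C C0 hC] := U_ae_le.
have e2 : 0 < e / 2 by rewrite divr_gt0.
have [r r0 [D1 aD1 hD1]] := sphere_sobolev_unif_continuous k2 Sf1 e2.
(* [eta ^- 2] is then [r], the scale at which f1 oscillates by at most e/2; [L] below is chosen so
   that the diameter bound [2 * eta / L] of the exceptional set equals [e]. *)
pose eta := (Num.sqrt r)^-1.
have eta0 : 0 < eta by rewrite invr_gt0 sqrtr_gt0.
have etar : eta ^- 2 = r by rewrite /eta exprVn invrK sqr_sqrtr// ltW.
pose L := 2 * eta / e.
have L0 : 0 < L by rewrite divr_gt0// mulr_gt0.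
have [K hK hKG] := exists_compact_subgroup_part L hG.
exists (e / (8 * C)); first by rewrite divr_gt0// mulr_gt0.
exists K => // eps1 eps2 h g /andP[e10 e1le] /andP[e20 e2le] U1 gK U2.
have small t : t <= e / (8 * C) -> C * t <= e / 8.
  by rewrite ler_pdivlMr ?mulr_gt0// => ht; rewrite ler_pdivlMr//; lra.
have [i [j /ltW LA]] := hKG g gK.
have [E [E1 E2]] := moebius_concentration (det_SL2 (repr g)) eta0 L0 LA.
have a1 := hC eps1 f1 h e10 Sf1 U1.
have a2 := hC eps2 f2 _ e20 Sf2 U2.
have a3 := ae_sphere_moebius_mx (det_SL2 (repr g)) (ae_sphere_and aD1 a1).
(* If [h \o moebius g] were near f2, then f2 would oscillate by at most e off the small set [E],
   which the choice of e forbids. *)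
apply: (he _ E (ae_sphere_and a2 a3)).
  move=> x y Ex Ey; apply: le_trans (E1 _ _ Ex Ey) _.
  by rewrite /L le_eqVlt; apply/orP; left; apply/eqP; field; rewrite !gt_eqF.
move=> x y [ax [Dx bx]] [ay [Dy by_]] nEx nEy l.
have c : chord (moebius g x) (moebius g y) <= r by rewrite -etar; exact: E2.
have hd := hD1 _ _ Dx Dy c l.
have h1 := le_trans (ax l) (small _ e2le).
have h2 := le_trans (ay l) (small _ e2le).
have h3 := le_trans (bx l) (small _ e1le).
have h4 := le_trans (by_ l) (small _ e1le).
exact: (dist_chain_le h1 h2 h3 h4 hd).
Qed.

End ReparametrizedMaps.


Theorem theorem1p1 (R : realType) (n m : nat) (M : topologicalType)
    (A : set (chart R n M)) (rho : chart R n M -> 'rV[R]_n -> 'M[R]_n)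
    (iota : M -> 'rV[R]_m) (k : nat) (p : R)
    (x1 x2 : sphere R) (G : set (PSL2 R)) (f1 f2 : sphere R -> M) :
  compact_manifold A ->
  riemannian_metric A rho ->
  smooth_embedding A iota ->
  1 <= p ->
  1 < k%:R - 2 / p ->
  x1 <> x2 ->
  [\/ G = G0 R, G = G1 x1 | G = G2 x1 x2] ->
  nonconstant_map iota k p f1 ->
  nonconstant_map iota k p f2 ->
  exists (eps1 eps2 : R) (K1 K2 : set (PSL2 R)),
    [/\ 0 < eps1 /\ 0 < eps2,
        compact K1 /\ K1 `<=` G,
        compact K2 /\ K2 `<=` G,
        forall h g, U_ iota k p eps1 f1 h -> (G `\` K1) g ->
          ~ U_ iota k p eps2 f2 (h \o moebius g) &
        forall h g, U_ iota k p eps2 f2 h -> (G `\` K2) g ->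
          ~ U_ iota k p eps1 f1 (h \o moebius g)].
Proof.
move=> _ _ [_ _ iota_inj _] p1 kp _ hG nf1 nf2.
(* As 2/p is nonnegative, k exceeds 1, and k is an integer. *)
have k2 : (2 <= k)%N.
  rewrite -(ltr_nat R); apply: lt_le_trans kp _.
  by rewrite gerBl divr_ge0// (le_trans ler01).
have [e1 e10 [K1 hK1 h1]] := properness_half iota_inj k2 p1 hG nf1 nf2.
have [e2 e20 [K2 hK2 h2]] := properness_half iota_inj k2 p1 hG nf2 nf1.
pose e := Num.min e1 e2.
have e0 : 0 < e by rewrite lt_min e10.
have ee1 : 0 < e <= e1 by rewrite e0 ge_min lexx.
have ee2 : 0 < e <= e2 by rewrite e0 ge_min lexx orbT.
exists e, e, K1, K2; split => // h g.
  exact: h1.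
exact: h2.
Qed.
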